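(* Let $f:\mathbb{R}^m\times\mathbb{R}^n\to\mathbb{R}$ be $\ell$-smooth, let $\mathcal{X}\subset\mathbb{R}^m$ and $\mathcal{Y}\subset\mathbb{R}^n$ be nonempty, closed, convex and bounded, and assume that $f(\cdot,y)$ is $\mu_x$-strongly convex for each $y\in\mathcal{Y}$ and $f(x,\cdot)$ is $\mu_y$-strongly concave for each $x\in\mathcal{X}$, where $\mu_x,\mu_y>0$. Let $x_0\in\mathcal{X}$, $y_0\in\mathcal{Y}$ and $\epsilon>0$. Then there exists $T>0$ such that the output $(\hat x,\hat y)=\text{Minimax-APPA}(f,x_0,y_0,\ell,\mu_x,\mu_y,\epsilon,T)$ is an $\epsilon$-saddle point of $f$, and the total number of gradient evaluations is bounded by $$O\left(\sqrt{\kappa_x\kappa_y}\,\log^3\left(\frac{(\kappa_x+\kappa_y)\,\ell\,(D_x^2+D_y^2)}{\epsilon}\right)\right),$$ where $\kappa_x=\ell/\mu_x$ and $\kappa_y=\ell/\mu_y$ are the condition numbers.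
   Context: Notation. $\|\cdot\|$ is the Euclidean norm; $\mathcal{P}_{\mathcal{Z}}$ is the Euclidean projection onto a closed convex set $\mathcal{Z}$; $D_x=\max_{x,x'\in\mathcal{X}}\|x-x'\|$ and $D_y=\max_{y,y'\in\mathcal{Y}}\|y-y'\|$. $O(\cdot)$ hides only absolute constants that do not depend on any problem parameter. A function $h$ is $\ell$-smooth if $\|\nabla h(z)-\nabla h(z')\|\le \ell\|z-z'\|$ for all $z,z'$ (for $f$, with respect to the joint variable $(x,y)$). A differentiable $\phi:\mathbb{R}^d\to\mathbb{R}$ is $\mu$-strongly convex if $\phi(x')\ge\phi(x)+(x'-x)^\top\nabla\phi(x)+(\mu/2)\|x'-x\|^2$ for all $x,x'\in\mathbb{R}^d$, and $\mu$-strongly concave if $-\phi$ is $\mu$-strongly convex. A point $(\hat x,\hat y)\in\mathcal{X}\times\mathcal{Y}$ is an $\epsilon$-saddle point of $f$ if $\max_{y\in\mathcal{Y}}f(\hat x,y)-\min_{x\in\mathcal{X}}f(x,\hat y)\le\epsilon$. Gradient evaluations are counted over the whole run, including all inner procedures. Procedure $\mathrm{AGD}(h,\mathcal{Z},z_0,L,m,\tau)$. Set $\tilde z_0=z_0$, $\kappa=L/m$, $\eta=1/L$, $\theta=\frac{\sqrt\kappa-1}{\sqrt\kappa+1}$. For $t=1,2,\dots$: $z_t=\mathcal{P}_{\mathcal{Z}}[\tilde z_{t-1}-\eta\nabla h(\tilde z_{t-1})]$, $\tilde z_t=z_t+\theta(z_t-z_{t-1})$. Stop at the first $t\ge1$ with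 $\|z_t-\mathcal{P}_{\mathcal{Z}}(z_t-\eta\nabla h(z_t))\|^2\le\frac{\tau}{2\kappa^2(L-m)}$ (right side read as $+\infty$ if $L=m$) and output $\mathcal{P}_{\mathcal{Z}}(z_t-\eta\nabla h(z_t))$. Procedure $\text{Maximin-AG2}(g,x_0,y_0,L,m_1,m_2,\tau)$. Set $\tilde y_0=y_0$, $k_1=L/m_1$, $k_2=L/m_2$, $\eta=\frac{1}{2k_1L}$, $\theta=\frac{4\sqrt{k_1k_2}-1}{4\sqrt{k_1k_2}+1}$, $\tilde\tau=\frac{\tau}{(10k_1k_2)^7}$. For $t=1,2,\dots$: $\tilde x_{t-1}=\mathrm{AGD}(g(\cdot,\tilde y_{t-1}),\mathcal{X},x_0,L,m_1,\tilde\tau)$; $y_t=\mathcal{P}_{\mathcal{Y}}[\tilde y_{t-1}+\eta\nabla_yg(\tilde x_{t-1},\tilde y_{t-1})]$; $\tilde y_t=y_t+\theta(y_t-y_{t-1})$; $x_t=\mathrm{AGD}(g(\cdot,y_t),\mathcal{X},x_0,L,m_1,\tilde\tau)$. Stop at the first $t\ge1$ with $\|y_t-\mathcal{P}_{\mathcal{Y}}(y_t+\eta\nabla_yg(x_t,y_t))\|^2\le\frac{\tau}{(10k_1k_2)^4L}$ and output $\mathcal{P}_{\mathcal{X}}(x_t-\frac{1}{2k_2L}\nabla_xg(x_t,y_t))$. Procedure $\text{Minimax-APPA}(f,x_0,y_0,\ell,\mu_x,\mu_y,\epsilon,T)$. Set $\tilde x_0=x_0$, $\kappa_x=\ell/\mu_x$,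 $\kappa_y=\ell/\mu_y$, $\theta=\frac{2\sqrt{\kappa_x}-1}{2\sqrt{\kappa_x}+1}$, $\delta=\frac{\epsilon}{(10\kappa_x\kappa_y)^4}$, $\tilde\epsilon=\frac{\epsilon}{10^2\kappa_x\kappa_y}$. For $t=1,\dots,T$: with $g_t(x,y)=f(x,y)+\ell\|x-\tilde x_{t-1}\|^2$, set $x_t=\text{Maximin-AG2}(g_t,x_0,y_0,3\ell,2\ell,\mu_y,\delta)$ and $\tilde x_t=x_t+\theta(x_t-x_{t-1})$. Then set $\tilde y=\mathrm{AGD}(-f(x_T,\cdot),\mathcal{Y},y_0,\ell,\mu_y,\tilde\epsilon)$ and $y_T=\mathcal{P}_{\mathcal{Y}}(\tilde y+\frac{1}{2\kappa_x\ell}\nabla_yf(x_T,\tilde y))$, and output $(x_T,y_T)$.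
   Formalization: In the logarithm, the factor ℓ(Dx²+Dy²)/ε is replaced by max(1, ℓ(Dx²+Dy²)/ε), since for large ε the stated bound is zero, negative or undefined while every run evaluates gradients; dimensions m, n are assumed at least 1. *)

(* Defs.v *)
(* The points of R^d are row vectors 'rV[R]_d.  The library
   norm `|x| on 'rV[R]_d is the sup norm: it provides the topology, hence
   [closed], [bounded_set] and [differentiable], which do not depend on the
   choice of a norm.  Every quantitative notion below uses [enorm]. *)
From HB Require Import structures.
From mathcomp Require Import all_boot all_order all_algebra.
From mathcomp Require Import all_classical all_reals all_analysis.

Set Implicit Arguments.
Unset Strict Implicit.
Unset Printing Implicit Defensive.
Import Order.TTheory GRing.Theory Num.Theory.
Import numFieldNormedType.Exports.
Local Open Scope classical_set_scope.
Local Open Scope ring_scope.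

Section Euclidean.
Context {R : realType} {d : nat}.
Implicit Types (x v : 'rV[R]_d) (Z : set 'rV[R]_d) (h : 'rV[R]_d -> R).

Definition dotp x v : R := \sum_(i < d) x 0 i * v 0 i.

Definition enorm x : R := Num.sqrt (dotp x x).

Definition proj Z v : 'rV[R]_d :=
  xget 0 [set p | Z p /\ forall q, Z q -> enorm (v - p) <= enorm (v - q)].

Definition diameter Z : R := sup [set enorm (p.1 - p.2) | p in Z `*` Z].

Definition grad h x : 'rV[R]_d := \row_(i < d) 'D_(delta_mx 0 i) h x.

Definition smooth (l : R) h : Prop :=
  (forall x, differentiable h x) /\
  (forall x x', enorm (grad h x - grad h x') <= l * enorm (x - x')).

Definition strongly_convex (mu : R) h : Prop :=
  (forall x, differentiable h x) /\
  (forall x x', h x + dotp (x' - x) (grad h x)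
                + mu / 2 * enorm (x' - x) ^+ 2 <= h x').

Definition strongly_concave (mu : R) h : Prop :=
  strongly_convex mu (fun x => - h x).

End Euclidean.

Definition jointly_smooth {R : realType} {m n : nat} (l : R)
    (f : 'rV[R]_m -> 'rV[R]_n -> R) : Prop :=
  smooth l (fun z : 'rV[R]_(m + n) => f (lsubmx z) (rsubmx z)).

Definition saddle_point {R : realType} {m n : nat} (eps : R)
    (f : 'rV[R]_m -> 'rV[R]_n -> R) (X : set 'rV[R]_m) (Y : set 'rV[R]_n)
    (xh : 'rV[R]_m) (yh : 'rV[R]_n) : Prop :=
  [/\ X xh, Y yh &
      sup [set f xh y | y in Y] - inf [set f x yh | x in X] <= eps].

Definition first_index (P : nat -> bool) : option nat :=
  if pselect (exists t, P t) is left exP then Some (ex_minn exP) else None.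

(* A procedure returns [Some] of its output paired with the number of gradient
   evaluations it made, or [None] if it, or a procedure it calls, never meets
   its stopping test.  A gradient that is used several times (in a stopping test
   and in the output) is counted once, and a gradient of the regularized
   function x, y |-> f x y + l * |x - xt|^2 is counted as one evaluation. *)

Section AGD.
Context {R : realType} {d : nat}.
Variables (h : 'rV[R]_d -> R) (Z : set 'rV[R]_d) (z0 : 'rV[R]_d) (L m tau : R).

Let kappa := L / m.
Let eta := L^-1.
Let theta := (Num.sqrt kappa - 1) / (Num.sqrt kappa + 1).

(* the pair (z_t, ~z_t) *)
Definition agd_iter (t : nat) : 'rV[R]_d * 'rV[R]_d :=
  iter t (fun p => let z := proj Z (p.2 - eta *: grad h p.2) in
                   (z, z + theta *: (z - p.1))) (z0, z0).

Definition agd_out (t : nat) : 'rV[R]_d :=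
  let z := (agd_iter t).1 in proj Z (z - eta *: grad h z).

Definition agd_stop (t : nat) : bool :=
  (0 < t)%N &&
  ((L == m) || (enorm ((agd_iter t).1 - agd_out t) ^+ 2
                <= tau / (2 * kappa ^+ 2 * (L - m)))).

(* Each iteration evaluates the gradient at ~z_(t-1) and at z_t. *)
Definition agd : option ('rV[R]_d * nat) :=
  omap (fun t => (agd_out t, 2 * t)%N) (first_index agd_stop).

End AGD.

Section MaximinAG2.
Context {R : realType} {m n : nat}.
Variables (g : 'rV[R]_m -> 'rV[R]_n -> R).
Variables (X : set 'rV[R]_m) (Y : set 'rV[R]_n).
Variables (x0 : 'rV[R]_m) (y0 : 'rV[R]_n) (L m1 m2 tau : R).

Let k1 := L / m1.
Let k2 := L / m2.
Let eta := (2 * k1 * L)^-1.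
Let theta := (4 * Num.sqrt (k1 * k2) - 1) / (4 * Num.sqrt (k1 * k2) + 1).
Let ttau := tau / (10 * k1 * k2) ^+ 7.

(* y_t, ~y_t, x_t and the number of gradient evaluations made so far *)
Definition ag2_state : Type := ('rV[R]_n * 'rV[R]_n * 'rV[R]_m * nat)%type.

(* The last evaluation counted is the one at (x_t, y_t) in the stopping test. *)
Definition ag2_step (s : ag2_state) : option ag2_state :=
  let: (y, yt, _, N) := s in
  obind (fun '(xt, N1) =>
    let y' := proj Y (yt + eta *: grad (g xt) yt) in
    let yt' := y' + theta *: (y' - y) in
    omap (fun '(x', N2) => (y', yt', x', (N + N1 + 1 + N2 + 1)%N))
         (agd (g^~ y') X x0 L m1 ttau))
  (agd (g^~ yt) X x0 L m1 ttau).

Definition ag2_iter (t : nat) : option ag2_state :=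
  iter t (obind ag2_step) (Some (y0, y0, x0, 0%N)).

Definition ag2_stop (t : nat) : bool :=
  (0 < t)%N &&
  if ag2_iter t is Some (y, _, x, _) then
    enorm (y - proj Y (y + eta *: grad (g x) y)) ^+ 2
    <= tau / ((10 * k1 * k2) ^+ 4 * L)
  else false.

Definition maximin_ag2 : option ('rV[R]_m * nat) :=
  obind (fun t =>
    omap (fun '(y, _, x, N) =>
            (proj X (x - (2 * k2 * L)^-1 *: grad (g^~ y) x), (N + 1)%N))
         (ag2_iter t))
  (first_index ag2_stop).

End MaximinAG2.

Section MinimaxAPPA.
Context {R : realType} {m n : nat}.
Variables (f : 'rV[R]_m -> 'rV[R]_n -> R).
Variables (X : set 'rV[R]_m) (Y : set 'rV[R]_n).
Variables (x0 : 'rV[R]_m) (y0 : 'rV[R]_n) (l mux muy eps : R).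

Let kx := l / mux.
Let ky := l / muy.
Let theta := (2 * Num.sqrt kx - 1) / (2 * Num.sqrt kx + 1).
Let delta := eps / (10 * kx * ky) ^+ 4.
Let teps := eps / (10 ^+ 2 * kx * ky).

(* x_t, ~x_t and the number of gradient evaluations made so far *)
Definition appa_state : Type := ('rV[R]_m * 'rV[R]_m * nat)%type.

Definition appa_step (s : appa_state) : option appa_state :=
  let: (x, xt, N) := s in
  let g x y := f x y + l * enorm (x - xt) ^+ 2 in
  omap (fun '(x', N') => (x', x' + theta *: (x' - x), (N + N')%N))
       (maximin_ag2 g X Y x0 y0 (3 * l) (2 * l) muy delta).

Definition minimax_appa (T : nat) : option ('rV[R]_m * 'rV[R]_n * nat) :=
  obind (fun '(xT, _, N) =>
    omap (fun '(yt, N') =>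
            (xT, proj Y (yt + (2 * kx * l)^-1 *: grad (f xT) yt), (N + N' + 1)%N))
         (agd (fun y => - f xT y) Y y0 l muy teps))
  (iter T (obind appa_step) (Some (x0, x0, 0%N))).

End MinimaxAPPA.

(* Main.v *)
Require Import Defs.
From HB Require Import structures.
From mathcomp Require Import all_boot all_order all_algebra.
From mathcomp Require Import all_classical all_reals all_analysis.
From mathcomp Require Import ring lra zify.
Set Implicit Arguments.
Unset Strict Implicit.
Unset Printing Implicit Defensive.
Import Order.TTheory GRing.Theory Num.Theory.
Import numFieldNormedType.Exports.
Import Defs.
Local Open Scope classical_set_scope.
Local Open Scope ring_scope.

(** Why the theorem holds.

    All three procedures are instances of one momentum scheme: a step S is applied
    to an extrapolated point, z_{t+1} = S (~z_t).  If S satisfies the inequality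
      F (S w) + L <w - S w, z - w> + L/2 |w - S w|^2 + a^2 L/2 |z - w|^2 - e <= F z
    for all w and all z of the feasible set, then with momentum weight
    (1 - a) / (1 + a) the potential F z_t - F z* + a^2 L/2 |v_t - z*|^2 contracts by
    1 - a at each step, up to e (momentum_rate).  Starting the potential after one
    step bounds it by L times the squared diameter, whatever the slope of F is;
    this is why only l D^2 enters the logarithm.

    - AGD: S is a projected gradient step on a smooth strongly convex function and
      e = 0 (exact_step_lower, agd_converges).  The inner calls have condition
      number 3/2 according to their parameters, but they also occur at
      extrapolated points y outside Y, where f need not be convex in x.  The
      proximal term alone makes the projected step a contraction of factor 2/3,
      which is enough for a rate independent of the problem (agd_contracts).

    - Maximin-AG2: F y = - min_x (f x y + l |x - xc|^2) is strongly convex and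
      2l-smooth on the whole space (partial_min_lower), the step uses an
      approximate gradient, and the momentum is tuned for a modulus 8 times
      smaller than the true one and a smoothness constant 9l; this slack absorbs
      the error of the inner solver (absorb_gradient_error, outer_rate).  When the
      stopping test holds, the final projected gradient step along x yields the
      optimality condition of the proximal subproblem up to a small linear term e
      (ag2_output).  Distances to the solution would not do here: a function with a
      large gradient at a constrained minimizer has a large value gap at a small
      distance.

    - Minimax-APPA: with F x = max_y f x y, such an inexact proximal step satisfies
      the inequality above with L = 2l and a = 1 / (2 sqrt kx), half of the strong
      convexity being spent on e and on the change of base point
      (prox_to_gradient_model, proximal_scheme_rate).

    For the output (x, y), the last gradient step along y makes f x y nearly
    maximal over Y, and the optimality condition of the last proximal step, whose
    proximal term is small because successive iterates are close, makes it nearly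
    minimal over X (output_gap).  The tolerances prescribed by the procedures are
    eps over powers of kx and ky, large enough powers for these bounds
    (output_error_le, outer_threshold, gap_budget).

    A loop of rate a meets a tolerance eps / poly in O(ln Lam / a) steps, where
    Lam = (kx + ky) max (1, l D^2 / eps).  The rates are of order 1 / sqrt kx for
    the proximal loop, 1 / sqrt ky for Maximin-AG2 and the final call of AGD, and
    constant for the inner calls of AGD; the three nested loops multiply to
    sqrt (kx ky) ln^3 Lam (total_count). *)

(** * Euclidean geometry *)

Section EuclideanGeometry.
Context {R : realType} {d : nat}.
Implicit Types (u v w : 'rV[R]_d) (a c : R).

Lemma dotpC u v : dotp u v = dotp v u.
Proof. by apply: eq_bigr => i _; rewrite mulrC. Qed.

Lemma dotpDl u v w : dotp (u + v) w = dotp u w + dotp v w.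
Proof. by rewrite -big_split; apply: eq_bigr => i _; rewrite mxE mulrDl. Qed.

Lemma dotpZl a u v : dotp (a *: u) v = a * dotp u v.
Proof. by rewrite mulr_sumr; apply: eq_bigr => i _; rewrite mxE mulrA. Qed.

Lemma dotpNl u v : dotp (- u) v = - dotp u v.
Proof. by rewrite -scaleN1r dotpZl mulN1r. Qed.

Lemma dotpDr u v w : dotp w (u + v) = dotp w u + dotp w v.
Proof. by rewrite dotpC dotpDl !(dotpC _ w). Qed.

Lemma dotpZr a u v : dotp v (a *: u) = a * dotp v u.
Proof. by rewrite dotpC dotpZl dotpC. Qed.

Lemma dotpNr u v : dotp v (- u) = - dotp v u.
Proof. by rewrite dotpC dotpNl dotpC. Qed.

Definition dotpE := (dotpDl, dotpDr, dotpNl, dotpNr, dotpZl, dotpZr).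

Lemma dotp0l u : dotp 0 u = 0.
Proof. by rewrite -(scale0r 0) dotpZl mul0r. Qed.

Lemma dotp_ge0 u : 0 <= dotp u u.
Proof. by apply: sumr_ge0 => i _; exact: sqr_ge0. Qed.

Lemma dotp_eq0 u : dotp u u <= 0 -> u = 0.
Proof.
move=> u0; have {u0} /eqP : dotp u u = 0 by apply/eqP; rewrite eq_le u0 dotp_ge0.
rewrite psumr_eq0; last by move=> i _; exact: sqr_ge0.
move=> /allP u0; apply/rowP => i; rewrite mxE.
by have := u0 i (mem_index_enum i); rewrite -expr2 sqrf_eq0 => /eqP.
Qed.

Lemma sqr_enorm u : enorm u ^+ 2 = dotp u u.
Proof. by rewrite sqr_sqrtr // dotp_ge0. Qed.

Lemma enorm_ge0 u : 0 <= enorm u.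
Proof. exact: sqrtr_ge0. Qed.

Lemma ler_enorm u v : (enorm u <= enorm v) = (dotp u u <= dotp v v).
Proof. by rewrite -ler_sqr ?nnegrE ?enorm_ge0 // !sqr_enorm. Qed.

Lemma enorm_le u a : 0 <= a -> (enorm u <= a) = (dotp u u <= a ^+ 2).
Proof. by move=> a0; rewrite -ler_sqr ?nnegrE ?enorm_ge0 // sqr_enorm. Qed.

(** Young's inequality, the way inexact gradients are absorbed below. *)
Lemma dotp_young c u v : 0 < c ->
  `|dotp u v| <= c * dotp u u + dotp v v / (4 * c).
Proof.
move=> c0; rewrite ler_norml.
have h (s : R) : s ^+ 2 = 1 ->
  0 <= c * dotp u u + s * dotp u v + dotp v v / (4 * c).
  move=> s2; have := dotp_ge0 (c *: u + (s / 2) *: v).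
  rewrite !dotpE (dotpC v u) => h.
  suff : 0 <= c * (c * dotp u u + s * dotp u v + dotp v v / (4 * c)).
    by rewrite pmulr_rge0.
  have -> : c * (c * dotp u u + s * dotp u v + dotp v v / (4 * c)) =
    c * (c * dotp u u) + s / 2 * (c * dotp u v)
    + (c * (s / 2 * dotp u v) + s / 2 * (s / 2 * dotp v v))
    + (1 - s ^+ 2) / 4 * dotp v v by field; exact: lt0r_neq0.
  by rewrite s2 subrr mul0r mul0r addr0; move: h; congr (_ <= _); ring.
have h1 := h 1 (expr1n _ _).
have h2 : 0 <= c * dotp u u + -1 * dotp u v + dotp v v / (4 * c).
  by apply: h; rewrite sqrrN expr1n.
by apply/andP; split; lra.
Qed.

Lemma dotp_cs u v : `|dotp u v| <= enorm u * enorm v.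
Proof.
have [/eqP u0|u0] := boolP (enorm u == 0).
  suff -> : u = 0 by rewrite dotp0l normr0 mulr_ge0 ?enorm_ge0.
  by apply: dotp_eq0; rewrite -sqr_enorm u0 expr0n.
have [/eqP v0|v0] := boolP (enorm v == 0).
  suff -> : v = 0 by rewrite dotpC dotp0l normr0 mulr_ge0 ?enorm_ge0.
  by apply: dotp_eq0; rewrite -sqr_enorm v0 expr0n.
have pu : 0 < enorm u by rewrite lt0r u0 enorm_ge0.
have pv : 0 < enorm v by rewrite lt0r v0 enorm_ge0.
have c0 : 0 < enorm v / (2 * enorm u) by rewrite divr_gt0 // mulr_gt0.
apply: le_trans (dotp_young u v c0) _.
rewrite -!sqr_enorm le_eqVlt; apply/orP; left; apply/eqP; field.
by rewrite u0 v0.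
Qed.

Lemma enorm_triangle u v : enorm (u + v) <= enorm u + enorm v.
Proof.
rewrite enorm_le ?addr_ge0 ?enorm_ge0 // !dotpE (dotpC v u) sqrrD -!sqr_enorm.
have := dotp_cs u v; have := ler_norm (dotp u v); lra.
Qed.

Lemma enormN u : enorm (- u) = enorm u.
Proof. by rewrite /enorm dotpNl dotpNr opprK. Qed.

Lemma enormB u v : enorm (u - v) = enorm (v - u).
Proof. by rewrite -enormN opprB. Qed.

Lemma enormZ a u : 0 <= a -> enorm (a *: u) = a * enorm u.
Proof.
move=> a0; rewrite /enorm dotpZl dotpZr mulrA -expr2 sqrtrM ?sqr_ge0 //.
by rewrite sqrtr_sqr ger0_norm.
Qed.

Lemma dotpD_le3 u v w :
  dotp (u + v + w) (u + v + w) <= 3 * (dotp u u + dotp v v + dotp w w).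
Proof.
have := dotp_ge0 (u - v); have := dotp_ge0 (u - w); have := dotp_ge0 (v - w).
rewrite !dotpE (dotpC v u) (dotpC w u) (dotpC w v); lra.
Qed.

Lemma coord_le_normr u i : `|u 0 i| <= `|u|.
Proof.
rewrite [leRHS](mx_normrE u).
exact: (@le_bigmax_cond _ _ _ _ (0, i) _ (fun ij : 'I_1 * 'I_d => `|u ij.1 ij.2|)).
Qed.

Lemma enorm_le_normr u : enorm u <= Num.sqrt d%:R * `|u|.
Proof.
rewrite -ler_sqr ?nnegrE ?mulr_ge0 ?sqrtr_ge0 ?enorm_ge0 // sqr_enorm exprMn.
rewrite sqr_sqrtr // /dotp.
rewrite -[d in d%:R]card_ord -sum1_card natr_sum mulr_suml; apply: ler_sum => i _.
rewrite mul1r -expr2 -real_normK ?num_real // ler_sqr ?nnegrE //.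
exact: coord_le_normr.
Qed.

End EuclideanGeometry.

(** Expands inner products of linear combinations in the goal and identifies
    symmetric ones, leaving a problem that is linear in the inner products of
    the variables. *)
Ltac dotp_expand :=
  rewrite ?dotpE;
  repeat match goal with |- context [dotp ?a ?b] =>
    lazymatch a with
    | b => fail
    | _ => match goal with |- context [dotp b a] => rewrite !(dotpC b a) end
    end
  end.

(** * Minimization over a convex body and Euclidean projection *)

Definition convex_body {R : realType} {d : nat} (Z : set 'rV[R]_d) : Prop :=
  [/\ Z !=set0, closed Z, convex_set Z & bounded_set Z].

Section ConvexBody.
Context {R : realType} {d : nat}.
Implicit Types (u v w z p q : 'rV[R]_d) (Z : set 'rV[R]_d) (h : 'rV[R]_d -> R).

Lemma convex_bodyP Z p q (t : R) : convex_body Z -> Z p -> Z q ->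
  0 <= t -> t <= 1 -> Z (p + t *: (q - p)).
Proof.
move=> [_ _ cZ _] Zp Zq t0 t1.
have := cZ q p (Itv01 t0 t1).
rewrite !inE => /(_ Zq Zp); congr Z.
have -> : p + t *: (q - p) = t *: q + (1 - t) *: p; last by [].
by rewrite scalerBr scalerBl scale1r addrCA.
Qed.

(** A first-order Taylor bound with quadratic remainder forces continuity, so
    a minimum is attained by compactness. *)
Lemma argmin_exists Z h (gr : 'rV[R]_d -> 'rV[R]_d) (c : R) :
  convex_body Z ->
  (forall z z', Z z -> Z z' ->
     `|h z' - h z - dotp (gr z) (z' - z)| <= c * dotp (z' - z) (z' - z)) ->
  exists2 z, Z z & forall z', Z z' -> h z <= h z'.
Proof.
move=> [Z0 Zc _ Zb] hc.
suff ch : {within Z, continuous h}.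
  have [z zZ zmin] := EVT_min_rV Z0 (bounded_closed_compact Zb Zc) ch.
  by exists z => [|z' Zz']; [rewrite inE in zZ | apply: zmin; rewrite inE].
apply/subspace_continuousP => z Zz.
set s := Num.sqrt d%:R : R; have s0 : 0 <= s := sqrtr_ge0 _.
set K := enorm (gr z) * s + `|c| * s ^+ 2 + 1.
have K0 : 0 < K by rewrite ltr_wpDl // addr_ge0 ?mulr_ge0 ?enorm_ge0 ?sqr_ge0.
apply/cvgrPdist_le => e e0.
have r0 : 0 < Num.min 1 (e / K) by rewrite lt_min ltr01 divr_gt0.
apply/nbhs_ballP; exists (Num.min 1 (e / K)) => //= z'.
rewrite -ball_normE /= lt_min distrC => /andP[z1 ze] Zz'.
have ds : enorm (z' - z) <= s * `|z' - z| := enorm_le_normr _.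
have n0 : 0 <= `|z' - z| by [].
rewrite distrC; set D := z' - z in ds n0 z1 ze *.
have hD : `|h z' - h z| <= `|c| * dotp D D + `|dotp (gr z) D|.
  have -> : h z' - h z = (h z' - h z - dotp (gr z) D) + dotp (gr z) D.
    by rewrite subrK.
  apply: le_trans (ler_normD _ _) _; rewrite lerD2r.
  apply: le_trans (hc _ _ Zz Zz') _.
  by rewrite ler_wpM2r ?dotp_ge0 // ler_norm.
apply: le_trans hD _.
have h1 : `|dotp (gr z) D| <= enorm (gr z) * s * `|D|.
  apply: le_trans (dotp_cs _ _) _.
  by rewrite -mulrA ler_wpM2l ?enorm_ge0.
have h2 : dotp D D <= s ^+ 2 * `|D|.
  rewrite -sqr_enorm; apply: (@le_trans _ _ ((s * `|D|) ^+ 2)).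
    by rewrite ler_sqr ?nnegrE ?mulr_ge0 ?enorm_ge0.
  rewrite exprMn ler_wpM2l ?sqr_ge0 // expr2 ler_piMr // ltW //.
have h3 : `|c| * dotp D D <= `|c| * (s ^+ 2 * `|D|) by rewrite ler_wpM2l.
have h4 : K * `|D| <= e by rewrite -ler_pdivlMl // mulrC ltW.
rewrite /K in h4; lra.
Qed.

Lemma minimizer_first_order Z h (g z : 'rV[R]_d) (c : R) :
  convex_body Z -> 0 <= c -> Z z ->
  (forall z', Z z' -> h z' <= h z + dotp g (z' - z) + c * dotp (z' - z) (z' - z)) ->
  (forall z', Z z' -> h z <= h z') ->
  forall z', Z z' -> 0 <= dotp g (z' - z).
Proof.
move=> cZ c0 Zz hub zmin z' Zz'; rewrite leNgt; apply/negP => gneg.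
set D := z' - z in gneg *; set a := - dotp g D.
have a0 : 0 < a by rewrite oppr_gt0.
set n := c * dotp D D; have n0 : 0 <= n by rewrite mulr_ge0 ?dotp_ge0.
set t := a / (a + n).
have an0 : 0 < a + n by rewrite ltr_wpDr.
have t0 : 0 < t by rewrite divr_gt0.
have t1 : t <= 1 by rewrite ler_pdivrMr // mul1r lerDl.
have Zt := convex_bodyP cZ Zz Zz' (ltW t0) t1.
have := le_trans (zmin _ Zt) (hub _ Zt).
rewrite -/D (addrC z) addrK !(dotpZl, dotpZr) => h1.
have h2 : 0 <= t * (t * n - a) by rewrite /n /a; lra.
rewrite pmulr_rge0 // in h2.
have h3 : t * (a + n) = a by rewrite /t divfK ?lt0r_neq0.
have h4 : 0 < t * a by rewrite mulr_gt0.
lra.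
Qed.

Section Projection.
Variables (Z : set 'rV[R]_d) (cZ : convex_body Z).

Lemma projP v :
  Z (proj Z v) /\ forall q, Z q -> enorm (v - proj Z v) <= enorm (v - q).
Proof.
have [p Zp pmin] : exists2 p, Z p & forall q, Z q ->
    dotp (v - p) (v - p) <= dotp (v - q) (v - q).
  apply: (argmin_exists (gr := fun z => - 2 *: (v - z)) (c := 1) cZ) => z z' _ _.
  rewrite (_ : _ - _ - _ = dotp (z' - z) (z' - z)) ?mul1r ?ger0_norm ?dotp_ge0 //.
  by dotp_expand; ring.
rewrite /proj; case: xgetP => [y -> [] //|/(_ p)[]].
by split=> // q Zq; rewrite ler_enorm pmin.
Qed.

Lemma proj_in v : Z (proj Z v).
Proof. exact: (projP v).1. Qed.

Lemma proj_vi v q : Z q -> dotp (v - proj Z v) (q - proj Z v) <= 0.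
Proof.
set p := proj Z v => Zq; have Zp : Z p := proj_in v.
suff : 0 <= dotp (- 2 *: (v - p)) (q - p) by rewrite dotpZl; lra.
apply: (minimizer_first_order (h := fun z => dotp (v - z) (v - z)) cZ ler01 Zp) => //.
- move=> z _; rewrite le_eqVlt; apply/orP; left; apply/eqP.
  by dotp_expand; ring.
- by move=> z Zz; rewrite -ler_enorm; exact: (projP v).2.
Qed.

Lemma proj_unique v p : Z p ->
  (forall q, Z q -> dotp (v - p) (q - p) <= 0) -> proj Z v = p.
Proof.
move=> Zp pvi; apply/eqP; rewrite -subr_eq0; apply/eqP/dotp_eq0.
have := pvi _ (proj_in v); have := proj_vi v Zp; set q := proj Z v.
by dotp_expand; lra.
Qed.

Lemma proj_nonexpansive u v : enorm (proj Z u - proj Z v) <= enorm (u - v).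
Proof.
have := proj_vi u (proj_in v); have := proj_vi v (proj_in u).
move: (proj Z u) (proj Z v) => p q h1 h2.
rewrite ler_enorm.
have h3 := dotp_ge0 ((u - v) - (p - q)).
by move: h1 h2 h3; dotp_expand; lra.
Qed.

Lemma diameter_ge u v : Z u -> Z v -> enorm (u - v) <= diameter Z.
Proof.
move=> Zu Zv; apply: ub_le_sup; last by exists (u, v).
have [_ _ _ Zb] := cZ; have [M [_ MZ]] := Zb.
have {MZ} MZ w : Z w -> `|w| <= M + 1 by apply: (MZ (M + 1)); rewrite ltrDl.
exists (Num.sqrt d%:R * (M + 1 + (M + 1))) => _ [[p q] [/= Zp Zq] <-].
apply: le_trans (enorm_le_normr _) _; rewrite ler_wpM2l ?sqrtr_ge0 //.
by apply: le_trans (ler_normB _ _) _; rewrite lerD ?MZ.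
Qed.

End Projection.
End ConvexBody.

(** * Smoothness *)

Section Smoothness.
Context {R : realType} {d : nat}.
Implicit Types (x y v : 'rV[R]_d) (h : 'rV[R]_d -> R).

Lemma derive_grad h x v : differentiable h x -> 'D_v h x = dotp v (grad h x).
Proof.
move=> dh; rewrite deriveE // {1}(row_sum_delta v) linear_sum /=.
by apply: eq_bigr => i _; rewrite linearZ /= mxE deriveE.
Qed.

Lemma is_derive_line h x v (t : R) : (forall z, differentiable h z) ->
  is_derive t 1 (fun s : R => h (x + s *: v)) (dotp v (grad h (x + t *: v))).
Proof.
move=> dh.
have E : (fun k : R => k^-1 *: (((fun s : R => h (x + s *: v)) \o shift t) (k *: 1)
            - h (x + t *: v))) =
         (fun k : R => k^-1 *: ((h \o shift (x + t *: v)) (k *: v)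
            - h (x + t *: v))).
  apply/funext => k /=; congr (_ *: (h _ - _)).
  by rewrite [k *: 1]mulr1 scalerDl addrCA.
apply: DeriveDef.
- by rewrite /derivable E; exact: diff_derivable.
- by rewrite /derive E -/(derive h _ _) derive_grad.
Qed.

(** The quadratic Taylor bound: the derivative of h along the segment differs
    from its initial value by at most L t |y - x| ^ 2. *)
Lemma smooth_taylor (L : R) h x y : smooth L h ->
  `|h y - h x - dotp (grad h x) (y - x)| <= L / 2 * dotp (y - x) (y - x).
Proof.
move=> [dh lh]; set v := y - x; set c := dotp (grad h x) v; set n := dotp v v.
have one (s : R) : `|s| = 1 -> s * (h y - h x - c) <= L / 2 * n.
  move=> s1.
  pose psi (t : R) := s * (h (x + t *: v) - t * c) - L / 2 * n * t ^+ 2.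
  have dpsi (t : R) : is_derive t 1 psi
      (s * (dotp v (grad h (x + t *: v)) - c) - L * n * t).
    have dl := is_derive_line x v t dh.
    apply: is_derive_eq.
    by rewrite scaler0 add0r /GRing.scale /=; field.
  have cpsi : {within `[(0 : R), 1], continuous psi}.
    apply: continuous_subspaceT => t.
    by apply: differentiable_continuous; apply/derivable1_diffP; exact: ex_derive.
  have [t] := MVT_segment ler01 (fun t _ => dpsi t) cpsi.
  rewrite in_itv /= => /andP[t0 _]; rewrite subr0 mulr1 => E.
  suff : psi 1 - psi 0 <= 0.
    rewrite /psi scale1r scale0r addr0 /v (addrC x) subrK; lra.
  rewrite E subr_le0.
  have -> : dotp v (grad h (x + t *: v)) - c =
            dotp v (grad h (x + t *: v) - grad h x).
    by rewrite /c (dotpC (grad h x)) dotpDr dotpNr.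
  apply: le_trans (ler_norm _) _; rewrite normrM s1 mul1r.
  apply: le_trans (dotp_cs _ _) _.
  have h1 := lh (x + t *: v) x.
  rewrite (addrC x) addrK enormZ // in h1.
  have -> : L * n * t = enorm v * (L * (t * enorm v)).
    by rewrite /n -sqr_enorm; ring.
  by rewrite (addrC x); exact: (ler_wpM2l (enorm_ge0 v) h1).
rewrite ler_norml; have := one 1 (normr1 _).
have := one (-1); rewrite normrN normr1 => /(_ erefl).
by move=> h1 h2; apply/andP; split; lra.
Qed.

End Smoothness.

Section Joint.
Context {R : realType} {m n : nat}.
Variables (f : 'rV[R]_m -> 'rV[R]_n -> R) (l : R) (fs : jointly_smooth l f).
Implicit Types (x u : 'rV[R]_m) (y v : 'rV[R]_n).

Let F (z : 'rV[R]_(m + n)) : R := f (lsubmx z) (rsubmx z).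

Lemma dotp_row_mx x y u v : dotp (row_mx x y) (row_mx u v) = dotp x u + dotp y v.
Proof.
rewrite /dotp big_split_ord; congr (_ + _); apply: eq_bigr => i _.
  by rewrite !row_mxEl.
by rewrite !row_mxEr.
Qed.

Let quotx x y u : 
  (fun k : R => k^-1 *: (((f^~ y) \o shift x) (k *: u) - f x y)) =
  (fun k : R => k^-1 *: ((F \o shift (row_mx x y)) (k *: row_mx u 0) - F (row_mx x y))).
Proof.
apply/funext => k /=.
by rewrite /F scale_row_mx scaler0 add_row_mx add0r !row_mxKl !row_mxKr.
Qed.

Let quoty x y v : 
  (fun k : R => k^-1 *: (((f x) \o shift y) (k *: v) - f x y)) =
  (fun k : R => k^-1 *: ((F \o shift (row_mx x y)) (k *: row_mx 0 v) - F (row_mx x y))).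
Proof.
apply/funext => k /=.
by rewrite /F scale_row_mx scaler0 add_row_mx add0r !row_mxKl !row_mxKr.
Qed.

Lemma derivable_fx x y u : derivable (f^~ y) x u.
Proof. by rewrite /derivable quotx; apply: diff_derivable; exact: fs.1. Qed.

Lemma derivable_fy x y v : derivable (f x) y v.
Proof. by rewrite /derivable quoty; apply: diff_derivable; exact: fs.1. Qed.

Let grad_joint x y : grad F (row_mx x y) = row_mx (grad (f^~ y) x) (grad (f x) y).
Proof.
apply/rowP => i; rewrite mxE; case: (split_ordP i) => j ->.
  by rewrite row_mxEl mxE /derive quotx -delta_mx_lshift.
by rewrite row_mxEr mxE /derive quoty -delta_mx_rshift.
Qed.

Lemma taylor_x x x' y :
  `|f x' y - f x y - dotp (grad (f^~ y) x) (x' - x)|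
    <= l / 2 * dotp (x' - x) (x' - x).
Proof.
have := smooth_taylor (row_mx x y) (row_mx x' y) fs.
rewrite -/F grad_joint opp_row_mx add_row_mx !dotp_row_mx subrr.
by rewrite !(dotpC _ 0) !dotp0l !addr0 !row_mxKl !row_mxKr.
Qed.

Lemma taylor_y x y y' :
  `|f x y' - f x y - dotp (grad (f x) y) (y' - y)|
    <= l / 2 * dotp (y' - y) (y' - y).
Proof.
have := smooth_taylor (row_mx x y) (row_mx x y') fs.
rewrite -/F grad_joint opp_row_mx add_row_mx !dotp_row_mx subrr.
by rewrite !(dotpC _ 0) !dotp0l !add0r !row_mxKl !row_mxKr.
Qed.

Let lip x y x' y' :
  Num.sqrt (dotp (grad (f^~ y) x - grad (f^~ y') x') (grad (f^~ y) x - grad (f^~ y') x')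
   + dotp (grad (f x) y - grad (f x') y') (grad (f x) y - grad (f x') y'))
  <= l * Num.sqrt (dotp (x - x') (x - x') + dotp (y - y') (y - y')).
Proof.
have := fs.2 (row_mx x y) (row_mx x' y').
by rewrite -/F !grad_joint !opp_row_mx !add_row_mx /enorm !dotp_row_mx.
Qed.

Lemma lip_xx x x' y :
  enorm (grad (f^~ y) x - grad (f^~ y) x') <= l * enorm (x - x').
Proof.
have := lip x y x' y; rewrite subrr dotp0l addr0; apply: le_trans.
by rewrite ler_wsqrtr // lerDl dotp_ge0.
Qed.

Lemma lip_xy x y y' :
  enorm (grad (f^~ y) x - grad (f^~ y') x) <= l * enorm (y - y').
Proof.
have := lip x y x y'; rewrite (subrr x) dotp0l add0r; apply: le_trans.
by rewrite ler_wsqrtr // lerDl dotp_ge0.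
Qed.

Lemma lip_yx x x' y :
  enorm (grad (f x) y - grad (f x') y) <= l * enorm (x - x').
Proof.
have := lip x y x' y; rewrite (subrr y) dotp0l addr0; apply: le_trans.
by rewrite ler_wsqrtr // lerDr dotp_ge0.
Qed.

Lemma lip_yy x y y' :
  enorm (grad (f x) y - grad (f x) y') <= l * enorm (y - y').
Proof.
have := lip x y x y'; rewrite (subrr x) dotp0l add0r; apply: le_trans.
by rewrite ler_wsqrtr // lerDr dotp_ge0.
Qed.

Lemma grad_oppy x y : grad (fun v => - f x v) y = - grad (f x) y.
Proof.
by apply/rowP => i; rewrite !mxE; exact: (deriveN (@derivable_fy x y _)).
Qed.

(** The Tikhonov term of the proximal subproblems. *)
Lemma grad_prox c x y (k : R) :
  grad (fun z => f z y + k * enorm (z - c) ^+ 2) x =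
  grad (f^~ y) x + (2 * k) *: (x - c).
Proof.
apply/rowP => i; rewrite !mxE; set e := delta_mx 0 i.
pose q z := k * enorm (z - c) ^+ 2.
have [dq eq] : derivable q x e /\ 'D_e q x = 2 * k * (x 0 i - c 0 i).
  have ei : dotp (x - c) e = x 0 i - c 0 i.
    rewrite /dotp (bigD1 i) //= big1 ?addr0 => [|j ji].
      by rewrite !mxE !eqxx mulr1.
    by rewrite !mxE (negbTE ji) andbF mulr0.
  suff H : (fun t : R => t^-1 *: ((q \o shift x) (t *: e) - q x)) @ 0^' -->
           2 * k * (x 0 i - c 0 i).
    by split; [apply/cvg_ex; exists (2 * k * (x 0 i - c 0 i)) | exact: cvg_lim].
  have E : {near 0^', (fun t : R => 2 * k * (x 0 i - c 0 i) + t * (k * dotp e e))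
             =1 (fun t : R => t^-1 *: ((q \o shift x) (t *: e) - q x))}.
    near=> t; rewrite /= /q !sqr_enorm -ei -addrA; set w := x - c.
    have t0 : t != 0 by near: t; exact: nbhs_dnbhs_neq.
    by clearbody w; dotp_expand; rewrite /GRing.scale /=; field.
  apply: (cvg_trans (near_eq_cvg E)).
  have C : 2 * k * (x 0 i - c 0 i) + t * (k * dotp e e) @[t --> 0^'] -->
           2 * k * (x 0 i - c 0 i) + 0 * (k * dotp e e).
    apply: cvg_within_filter.
    by apply: cvgD; [exact: cvg_cst | apply: cvgMl; exact: cvg_id].
  by rewrite mul0r addr0 in C.
by rewrite (deriveD (@derivable_fx x y e) dq) eq.
Unshelve. all: by end_near.
Qed.

End Joint.

(** The moduli of a lower and an upper quadratic model are compared along a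
    nonzero direction, which exists in positive dimension. *)
Lemma modulus_le {R : realType} {d : nat} (h : 'rV[R]_d -> R) gr (mu l : R) :
  (0 < d)%N ->
  (forall x y, h x + dotp (gr x) (y - x) + mu / 2 * dotp (y - x) (y - x) <= h y) ->
  (forall x y, h y <= h x + dotp (gr x) (y - x) + l / 2 * dotp (y - x) (y - x)) ->
  mu <= l.
Proof.
move=> d0 /(_ 0 (const_mx 1)) h1 /(_ 0 (const_mx 1)) h2.
have := le_trans h1 h2; rewrite lerD2l subr0.
have k0 : 0 < dotp (const_mx 1 : 'rV[R]_d) (const_mx 1).
  rewrite /dotp (eq_bigr (fun=> 1)) => [|i _]; last by rewrite !mxE mulr1.
  by rewrite sumr_const card_ord ltr0n.
by rewrite ler_pM2r // ler_pM2r // invr_gt0.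
Qed.

(** * Momentum *)

Section Momentum.
Context {R : realType} {d : nat}.
Implicit Types (x y z w : 'rV[R]_d).

(** The pairs (z_t, ~z_t) of a scheme that applies the step S to the
    extrapolated point; all three procedures are of this form. *)
Definition momentum (S : 'rV[R]_d -> 'rV[R]_d) (theta : R) z0 t :=
  iter t (fun p : 'rV[R]_d * 'rV[R]_d =>
    let z := S p.2 in (z, z + theta *: (z - p.1))) (z0, z0).

Variables (F : 'rV[R]_d -> R) (Z : set 'rV[R]_d) (S : 'rV[R]_d -> 'rV[R]_d).
Variables (z0 zs : 'rV[R]_d) (L a e D2 : R).
Hypotheses (L0 : 0 < L) (a0 : 0 < a) (a1 : a <= 1) (e0 : 0 <= e).
Hypotheses (Zz0 : Z z0) (Zzs : Z zs) (ZS : forall w, Z (S w)).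
Hypothesis diam : forall z z', Z z -> Z z' -> dotp (z - z') (z - z') <= D2.
Hypothesis step_lower : forall w z, Z z ->
  F (S w) + L * dotp (w - S w) (z - w) + L / 2 * dotp (w - S w) (w - S w)
    + a ^+ 2 * L / 2 * dotp (z - w) (z - w) - e <= F z.

Lemma momentum_in th t : Z (momentum S th z0 t).1.
Proof. by case: t => [|t] //=; exact: ZS. Qed.

Let theta : R := (1 - a) / (1 + a).
Let pair t := momentum S theta z0 t.

(* a (v - zs), where v = x + (1 + 1/a) (y - x) is the point whose a-average
   with x gives the extrapolated point y = (x + a v) / (1 + a). *)
Let lag (x y : 'rV[R]_d) := (1 + a) *: y - x - a *: zs.
Let potential (p : 'rV[R]_d * 'rV[R]_d) :=
  F p.1 - F zs + L / 2 * dotp (lag p.1 p.2) (lag p.1 p.2).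

Let lag_next x s : lag s (s + theta *: (s - x)) = s - (1 - a) *: x - a *: zs.
Proof.
rewrite /lag /theta; congr (_ - _).
rewrite scalerDr scalerA mulrCA divff ?mulr1; last first.
  by rewrite lt0r_neq0 // ltr_wpDr // ltW.
by apply/rowP => i; rewrite !mxE; ring.
Qed.

Let potential_step p : Z p.1 ->
  potential (S p.2, S p.2 + theta *: (S p.2 - p.1)) <= (1 - a) * potential p + e.
Proof.
case: p => x y /= Zx; rewrite /potential /= lag_next /lag.
have := step_lower y Zx; have := step_lower y Zzs; set s := S y.
move: (F s) (F x) (F zs) => Fs Fx Fz hz hx.
have hz' := ler_wpM2l (ltW a0) hz.
have b0 : 0 <= 1 - a by rewrite subr_ge0.
have hx' := ler_wpM2l b0 hx.
have k0 : 0 <= (1 - a) * (1 + a) * a * L / 2 * dotp (x - y) (x - y).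
  have ? := dotp_ge0 (x - y).
  by rewrite !mulr_ge0 // ?ltW // ltr_wpDr // ltW.
move: hz' hx' k0 {hz hx}; dotp_expand => hz' hx' k0.
lra.
Qed.

Let potential1 : potential (pair 1) <= L * D2 + e.
Proof.
rewrite /pair /= /potential /= lag_next.
have h := step_lower z0 Zzs; have := diam Zz0 (ZS z0); have := diam Zz0 Zzs.
have n1 := dotp_ge0 (zs - S z0).
have b0 : 0 <= (1 - a) * L by rewrite mulr_ge0 ?subr_ge0 // ltW.
set s := S z0 in h n1 *; move: (F s) (F zs) h => Fs Fz h d1 d2.
have k := ler_wpM2l b0 d1; have k2 := ler_wpM2l b0 d2.
have k3 := mulr_ge0 b0 n1.
have k4 : (1 - a) * L * D2 <= L * D2.
  rewrite -mulrA ler_piMl ?gerDl ?oppr_le0 ?(ltW a0) //.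
  by rewrite mulr_ge0 ?(ltW L0) //; apply: le_trans d1; exact: dotp_ge0.
move: h k k2 k3; dotp_expand => h k k2 k3.
lra.
Qed.

(** Linear convergence of inexact momentum schemes: the potential
    F z_t - F zs + (a^2 L / 2) |v_t - zs|^2 contracts by 1 - a up to the error e of
    each step.  It is started at t = 1 because F z_0 - F zs has no bound in
    terms of L and the diameter, whereas one step brings such a bound. *)
Lemma momentum_rate t :
  F (momentum S ((1 - a) / (1 + a)) z0 t.+1).1 - F zs <= (1 - a) ^+ t * (L * D2) + e / a.
Proof.
apply: (@le_trans _ _ (potential (pair t.+1))).
  by rewrite lerDl mulr_ge0 ?dotp_ge0 // divr_ge0 // ltW.
elim: t => [|t IH].
  rewrite expr0 mul1r; apply: le_trans potential1 _; rewrite lerD2l.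
  by rewrite ler_pdivlMr // ler_piMr.
have h : potential (pair t.+2) <= (1 - a) * potential (pair t.+1) + e.
  exact: (potential_step (momentum_in theta t.+1)).
apply: (le_trans h).
have b0 : 0 <= 1 - a by rewrite subr_ge0.
have h2 := ler_wpM2l b0 IH.
have -> : e / a = (1 - a) * (e / a) + e by field; exact: lt0r_neq0.
apply: (@le_trans _ _ ((1 - a) * ((1 - a) ^+ t * (L * D2) + e / a) + e)).
  by rewrite lerD2r.
by rewrite mulrDr exprS addrA mulrA.
Qed.

End Momentum.

(** * Projected gradient steps *)

Section ProjectedGradient.
Context {R : realType} {d : nat}.
Variables (Z : set 'rV[R]_d) (cZ : convex_body Z).
Implicit Types (u w z p : 'rV[R]_d) (h : 'rV[R]_d -> R).

Lemma proj_gradient_vi (L : R) u w z p : 0 < L -> Z z ->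
  p = proj Z (w - L^-1 *: u) ->
  L * dotp (w - p) (z - p) <= dotp u (z - p).
Proof.
move=> L0 Zz pE; have := proj_vi cZ (w - L^-1 *: u) Zz.
rewrite -pE; set D := z - p.
have -> : w - L^-1 *: u - p = (w - p) - L^-1 *: u by rewrite addrAC.
by rewrite (dotpDl (w - p)) dotpNl dotpZl subr_le0 ler_pdivlMl.
Qed.

Lemma fixed_pointP (L : R) g z : 0 < L -> Z z ->
  (forall z', Z z' -> 0 <= dotp g (z' - z)) -> proj Z (z - L^-1 *: g) = z.
Proof.
move=> L0 Zz vi; apply: proj_unique => // q Zq.
rewrite addrAC subrr add0r dotpNl dotpZl oppr_le0 mulr_ge0 ?invr_ge0 ?(ltW L0) //.
exact: vi.
Qed.

(** One projected step along an approximation u of the gradient g of h at w,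
    compared with any z of Z: the model bounds of h at w are combined with the
    variational inequality of the projection. *)
Lemma proj_gradient_lower h (L l mu : R) g u w z p : 0 < L -> Z z ->
  p = proj Z (w - L^-1 *: u) ->
  h p <= h w + dotp g (p - w) + l / 2 * dotp (p - w) (p - w) ->
  h w + dotp g (z - w) + mu / 2 * dotp (z - w) (z - w) <= h z ->
  h p + L * dotp (w - p) (z - p) - dotp (u - g) (z - p)
    - l / 2 * dotp (w - p) (w - p) + mu / 2 * dotp (z - w) (z - w) <= h z.
Proof.
move=> L0 Zz pE ub lb; have := proj_gradient_vi L0 Zz pE.
by move: ub lb; dotp_expand => ub lb vi; lra.
Qed.

Section ExactStep.
Variables (h : 'rV[R]_d -> R) (L m : R).
Hypotheses (m0 : 0 < m) (mL : m <= L).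
Hypothesis upper : forall x y,
  h y <= h x + dotp (grad h x) (y - x) + L / 2 * dotp (y - x) (y - x).
Hypothesis lower : forall x y,
  h x + dotp (grad h x) (y - x) + m / 2 * dotp (y - x) (y - x) <= h y.

Let L0 : 0 < L. Proof. exact: (lt_le_trans m0 mL). Qed.

Let step w := proj Z (w - L^-1 *: grad h w).

Lemma exact_step_lower w z : Z z ->
  h (step w) + L * dotp (w - step w) (z - w)
    + L / 2 * dotp (w - step w) (w - step w) + m / 2 * dotp (z - w) (z - w) <= h z.
Proof.
move=> Zz.
have := proj_gradient_lower L0 Zz (erefl (step w)) (upper w _) (lower w z).
rewrite subrr dotp0l subr0; set p := step w; clearbody p.
by dotp_expand => H; lra.
Qed.

Lemma exact_step_gain w z : Z z ->
  h (step w) - h z <= (L - m) / 2 * dotp (w - z) (w - z)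
                      - L / 2 * dotp (step w - z) (step w - z).
Proof.
move=> Zz; have := exact_step_lower w Zz; set p := step w; clearbody p.
by dotp_expand => H; lra.
Qed.

Variables (zs : 'rV[R]_d) (Zzs : Z zs).
Hypothesis zs_min : forall z, Z z -> h zs <= h z.

Lemma exact_minimizer_vi z : Z z -> 0 <= dotp (grad h zs) (z - zs).
Proof.
have l20 : 0 <= L / 2 by rewrite divr_ge0 // ltW.
exact: (minimizer_first_order cZ l20 Zzs (fun z _ => upper zs z) zs_min).
Qed.

Lemma exact_growth z : Z z -> h zs + m / 2 * dotp (z - zs) (z - zs) <= h z.
Proof.
by move=> Zz; have := exact_minimizer_vi Zz; have := lower zs z; lra.
Qed.

Lemma exact_step_contraction w :
  (L + m) * dotp (step w - zs) (step w - zs) <= (L - m) * dotp (w - zs) (w - zs).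
Proof.
have := exact_step_gain w Zzs; have := exact_growth (proj_in cZ _ : Z (step w)).
lra.
Qed.

Lemma exact_step_nonexpansive w : enorm (step w - zs) <= enorm (w - zs).
Proof.
rewrite ler_enorm; have := exact_step_contraction w.
have h1 := dotp_ge0 (step w - zs); have h2 := dotp_ge0 (w - zs) => h3.
have Lm : 0 < L + m by rewrite addr_gt0.
rewrite -(ler_pM2l Lm); apply: le_trans h3 _; rewrite ler_wpM2r //.
by rewrite lerD2l ge0_cp // ltW.
Qed.

(** The error bound of the stopping tests: the contraction factor
    sqrt ((L - m) / (L + m)) is at most 1 - m / (L + m). *)
Lemma exact_step_error_bound w :
  m * enorm (w - zs) <= (L + m) * enorm (w - step w).
Proof.
have Lm : 0 < L + m by rewrite addr_gt0.
have h1 : (L + m) * enorm (step w - zs) <= L * enorm (w - zs).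
  have n1 := enorm_ge0 (step w - zs); have n2 := enorm_ge0 (w - zs).
  rewrite -ler_sqr; [|by rewrite nnegrE mulr_ge0 // ltW..].
  rewrite !exprMn !sqr_enorm.
  have := ler_wpM2l (ltW Lm) (exact_step_contraction w).
  rewrite !mulrA -expr2 => h1; apply: le_trans h1 _.
  rewrite ler_wpM2r ?dotp_ge0 // mulrC -subr_sqr lerBlDr lerDl sqr_ge0 //.
have := enorm_triangle (w - step w) (step w - zs); rewrite addrA subrK => h2.
have := ler_wpM2l (ltW Lm) h2.
lra.
Qed.

End ExactStep.
End ProjectedGradient.

(** * The procedure AGD *)

Lemma first_indexP (P : nat -> bool) t : P t ->
  exists t', [/\ first_index P = Some t', P t' & (t' <= t)%N].
Proof.
move=> Pt; rewrite /first_index; case: pselect => [exP|]; last first.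
  by case; exists t.
by case: ex_minnP => t' Pt' min; exists t'; split => //; exact: min.
Qed.

Section AGDProof.
Context {R : realType} {d : nat}.
Variables (Z : set 'rV[R]_d) (cZ : convex_body Z).
Implicit Types (w z : 'rV[R]_d).

Lemma agd_iterE h z0 (L m : R) t : agd_iter h Z z0 L m t =
  momentum (fun w => proj Z (w - L^-1 *: grad h w))
    ((Num.sqrt (L / m) - 1) / (Num.sqrt (L / m) + 1)) z0 t.
Proof. by []. Qed.

Lemma agd_someP h z0 (L m tau : R) t : agd_stop h Z z0 L m tau t ->
  exists t', [/\ agd h Z z0 L m tau = Some (agd_out h Z z0 L m t', 2 * t')%N,
                 agd_stop h Z z0 L m tau t' & (t' <= t)%N].
Proof.
by move=> /first_indexP[t' [E st le]]; exists t'; rewrite /agd E.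
Qed.

Lemma momentum_weightE (s : R) : 0 < s -> (s - 1) / (s + 1) = (1 - s^-1) / (1 + s^-1).
Proof.
move=> s0; field; rewrite lt0r_neq0 // ?addr_gt0 //; apply/andP; split => //.
by rewrite lt0r_neq0 // addr_gt0.
Qed.

(** AGD on an m-strongly convex and L-smooth function.  When the stopping test
    holds, the error bound turns the residual into an optimality gap of at most
    tau; it holds after the number of steps given by the momentum rate. *)
Lemma agd_converges h z0 (L m tau D2 : R) t :
  Z z0 -> 0 < m -> m <= L ->
  (forall x y, h y <= h x + dotp (grad h x) (y - x) + L / 2 * dotp (y - x) (y - x)) ->
  (forall x y, h x + dotp (grad h x) (y - x) + m / 2 * dotp (y - x) (y - x) <= h y) ->
  (forall z z', Z z -> Z z' -> dotp (z - z') (z - z') <= D2) ->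
  16 * (L / m) ^+ 3 * ((1 - (Num.sqrt (L / m))^-1) ^+ t * (L * D2)) <= tau ->
  exists out t', [/\ agd h Z z0 L m tau = Some (out, 2 * t')%N, (t' <= t.+1)%N,
    Z out & forall z, Z z -> h out <= h z + tau].
Proof.
move=> Zz0 m0 mL upper lower diam ht.
have L0 : 0 < L := lt_le_trans m0 mL.
set k := L / m in ht *; have k1 : 1 <= k by rewrite ler_pdivlMr // mul1r.
have k0 : 0 < k := lt_le_trans ltr01 k1.
have Lk : L = k * m by rewrite divfK // lt0r_neq0.
set s := Num.sqrt k in ht *.
have s1 : 1 <= s by rewrite -sqrtr1 ler_wsqrtr.
have s0 : 0 < s := lt_le_trans ltr01 s1.
have [zs Zzs zs_min] : exists2 z, Z z & forall z', Z z' -> h z <= h z'.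
  apply: (argmin_exists (gr := grad h) (c := L / 2) cZ) => z z' _ _.
  rewrite ler_norml; have := upper z z'; have := lower z z'.
  have : 0 <= m / 2 * dotp (z' - z) (z' - z).
    by rewrite mulr_ge0 ?dotp_ge0 // divr_ge0 // ltW.
  have : 0 <= L / 2 * dotp (z' - z) (z' - z).
    by rewrite mulr_ge0 ?dotp_ge0 // divr_ge0 // ltW.
  by move=> *; apply/andP; split; lra.
have step_in w : Z (proj Z (w - L^-1 *: grad h w)) := proj_in cZ _.
have bound := exact_step_error_bound cZ m0 mL upper lower Zzs zs_min.
have stop : agd_stop h Z z0 L m tau t.+1.
  rewrite /agd_stop /agd_out; set zt := (agd_iter h Z z0 L m t.+1).1.
  have Zzt : Z zt by exact: step_in.
  case: (eqVneq L m) => // LneqM; rewrite orFb /=.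
  have Lm : 0 < L - m by rewrite subr_gt0 lt_neqAle eq_sym LneqM.
  have rate := @momentum_rate _ _ h Z (fun w => proj Z (w - L^-1 *: grad h w))
    z0 zs L s^-1 0 D2 L0.
  have {}rate : h zt - h zs <= (1 - s^-1) ^+ t * (L * D2).
    rewrite /zt agd_iterE momentum_weightE // -[leRHS]addr0.
    rewrite -[X in _ <= _ + X](mul0r (s^-1)^-1).
    apply: rate => //; rewrite ?invr_gt0 ?invf_le1 // => w z Zz.
    have -> : s^-1 ^+ 2 * L = m.
      by rewrite exprVn sqr_sqrtr ?ltW // Lk mulKf ?lt0r_neq0.
    by rewrite subr0; exact: (exact_step_lower cZ m0 mL upper lower).
  set p := proj Z _.
  have r2 : enorm (zt - p) <= 2 * enorm (zt - zs).
    have := exact_step_nonexpansive cZ m0 mL upper lower Zzs zs_min zt.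
    have := enorm_triangle (zt - zs) (zs - p); rewrite addrA subrK (enormB zs p).
    move=> tri ne; apply: le_trans tri _.
    by rewrite mulr_natl mulr2n lerD2l.
  have growth := exact_growth cZ m0 mL upper lower Zzs zs_min Zzt.
  have {}r2 : enorm (zt - p) ^+ 2 <= 4 * dotp (zt - zs) (zt - zs).
    have -> : 4 * dotp (zt - zs) (zt - zs) = (2 * enorm (zt - zs)) ^+ 2.
      by rewrite exprMn sqr_enorm -natrX.
    by rewrite ler_sqr ?nnegrE ?mulr_ge0 ?enorm_ge0.
  rewrite ler_pdivlMr; last by rewrite mulr_gt0 // mulr_gt0 // exprn_gt0.
  apply: le_trans (ler_wpM2r _ r2) _.
    by apply: mulr_ge0; [rewrite mulr_ge0 ?sqr_ge0|exact: ltW].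
  clearbody p zt; rewrite -/k; set B := _ * (L * D2) in ht rate.
  have n0 := dotp_ge0 (zt - zs).
  apply: le_trans ht.
  apply: (@le_trans _ _ (4 * dotp (zt - zs) (zt - zs) * (2 * k ^+ 2 * L))).
    have LmL : L - m <= L by rewrite gerDl oppr_le0 ltW.
    apply: ler_wpM2l; first by rewrite mulr_ge0.
    by apply: ler_wpM2l LmL; rewrite mulr_ge0 ?sqr_ge0.
  rewrite Lk.
  have -> : 4 * dotp (zt - zs) (zt - zs) * (2 * k ^+ 2 * (k * m)) =
            16 * k ^+ 3 * (m / 2 * dotp (zt - zs) (zt - zs)) by field.
  apply: ler_wpM2l; first by rewrite mulr_ge0 // exprn_ge0 // ltW.
  by apply: le_trans rate; rewrite lerBrDl.
have [t' [-> st' le]] := agd_someP stop.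
exists (agd_out h Z z0 L m t'), t'; split => //; first exact: step_in.
suff : h (agd_out h Z z0 L m t') <= h zs + tau.
  by move=> H z Zz; apply: le_trans H _; rewrite lerD2r zs_min.
move: st'; rewrite /agd_stop; set zt := (agd_iter h Z z0 L m t').1 => /andP[_ st'].
have := exact_step_gain cZ m0 mL upper lower zt Zzs.
have -> : proj Z (zt - L^-1 *: grad h zt) = agd_out h Z z0 L m t' by [].
set out := agd_out h Z z0 L m t' in st' * => gain.
have o0 := dotp_ge0 (out - zs).
have o1 : 0 <= L / 2 * dotp (out - zs) (out - zs).
  by rewrite mulr_ge0 // divr_ge0 // ltW.
suff : (L - m) / 2 * dotp (zt - zs) (zt - zs) <= tau by lra.
have tau0 : 0 <= tau.
  apply: le_trans ht; apply: mulr_ge0; first by rewrite mulr_ge0 // exprn_ge0 // ltW.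
  apply: mulr_ge0; first by rewrite exprn_ge0 // subr_ge0 invf_le1.
  by rewrite mulr_ge0 ?(ltW L0) //; apply: le_trans (diam _ _ Zzs Zzs); exact: dotp_ge0.
case/orP: st' => [/eqP ->|st'].
  by rewrite subrr !mul0r.
have [LeqM|LneqM] := eqVneq L m.
  by rewrite LeqM subrr !mul0r.
have Lm : 0 < L - m by rewrite subr_gt0 lt_neqAle eq_sym LneqM.
have bnd : enorm (zt - zs) <= 2 * k * enorm (zt - out).
  rewrite -(ler_pM2l m0); apply: le_trans (bound zt) _.
  have -> : m * (2 * k * enorm (zt - out)) = (L + L) * enorm (zt - out).
    by rewrite Lk; ring.
  by rewrite ler_wpM2r ?enorm_ge0 // lerD2l.
have {}bnd : dotp (zt - zs) (zt - zs) <= 4 * k ^+ 2 * enorm (zt - out) ^+ 2.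
  rewrite -sqr_enorm.
  have -> : 4 * k ^+ 2 * enorm (zt - out) ^+ 2 = (2 * k * enorm (zt - out)) ^+ 2.
    by ring.
  have k2 : 0 <= 2 * k by rewrite mulr_ge0 // ltW.
  by rewrite ler_sqr // nnegrE ?enorm_ge0 // mulr_ge0 ?enorm_ge0.
rewrite ler_pdivlMr in st'; last by rewrite mulr_gt0 // mulr_gt0 // exprn_gt0.
rewrite -/k in st'; apply: le_trans st'.
have Lm2 : 0 <= (L - m) / 2 by rewrite divr_ge0 // ltW.
apply: le_trans (ler_wpM2l Lm2 bnd) _.
by rewrite le_eqVlt; apply/orP; left; apply/eqP; field.
Qed.

(** The inner calls of AGD, whose momentum is tuned for a 2l-strongly convex
    function, can act on a function that is only l-strongly convex.  They
    converge nevertheless, because the projected step is a contraction of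
    factor 2/3 and the momentum weight is at most 0.11: if the extrapolated
    point is within 1.35 q of the limit, then two successive iterates are within
    0.9 q and q of it, and the next extrapolated point within 1.35 (0.9 q). *)
Lemma agd_contracts h x0 zs (l tau D : R) t :
  Z x0 -> 0 < l ->
  (forall w w', enorm ((w - (3 * l)^-1 *: grad h w) - (w' - (3 * l)^-1 *: grad h w'))
     <= 2 / 3 * enorm (w - w')) ->
  Z zs -> (forall z, Z z -> 0 <= dotp (grad h zs) (z - zs)) ->
  enorm (x0 - zs) <= D ->
  25 / 2 * ((9 / 10) ^+ t) ^+ 2 * (l * D ^+ 2) <= tau ->
  exists out t', [/\ agd h Z x0 (3 * l) (2 * l) tau = Some (out, 2 * t')%N,
    (t' <= t.+1)%N, Z out & l * dotp (out - zs) (out - zs) <= tau].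
Proof.
move=> Zx0 l0 lip Zzs vi x0D ht.
have L0 : 0 < 3 * l by rewrite mulr_gt0.
have D0 : 0 <= D := le_trans (enorm_ge0 _) x0D.
pose S w := proj Z (w - (3 * l)^-1 *: grad h w).
have Sfix : S zs = zs by exact: fixed_pointP.
have Sc w : enorm (S w - zs) <= 2 / 3 * enorm (w - zs).
  by rewrite -{1}Sfix; apply: le_trans (lip w zs); exact: proj_nonexpansive.
have resid w : enorm (w - S w) <= 5 / 3 * enorm (w - zs).
  have := enorm_triangle (w - zs) (zs - S w); rewrite addrA subrK (enormB zs).
  by have := Sc w; lra.
have err w : enorm (S w - zs) <= 2 * enorm (w - S w).
  have := enorm_triangle (w - S w) (S w - zs); rewrite addrA subrK.
  by have := Sc w; lra.
have kE : 3 * l / (2 * l) = 3 / 2 by field; exact: lt0r_neq0.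
pose theta : R := (Num.sqrt (3 / 2) - 1) / (Num.sqrt (3 / 2) + 1).
have [th0 th1] : 0 <= theta /\ theta <= 11 / 100.
  have s1 : 1 <= Num.sqrt (3 / 2 : R) by rewrite -{1}sqrtr1 ler_wsqrtr; lra.
  have s2 : Num.sqrt (3 / 2 : R) <= 49 / 40.
    have p49 : 0 <= 49 / 40 :> R by lra.
    rewrite -(ger0_norm p49) -sqrtr_sqr ler_wsqrtr // expr2; lra.
  have s0 : 0 < Num.sqrt (3 / 2 : R) + 1 by lra.
  rewrite /theta; move: (Num.sqrt _) s0 s1 s2 => s s0 s1 s2; split.
    by rewrite divr_ge0 ?subr_ge0 // ltW.
  by rewrite ler_pdivrMr //; lra.
pose it t := agd_iter h Z x0 (3 * l) (2 * l) t.
have itS k : it k.+1 = (S (it k).2, S (it k).2 + theta *: (S (it k).2 - (it k).1)).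
  by rewrite /it /= kE.
have rate k : enorm ((it k).1 - zs) <= D * (9 / 10) ^+ k /\
              enorm ((it k).2 - zs) <= 27 / 20 * (D * (9 / 10) ^+ k).
  elim: k => [|k [IH1 IH2]]; first by rewrite /it /= expr0 mulr1; split => //; lra.
  rewrite itS /= exprS; set q := D * _ in IH1 IH2.
  have q0 : 0 <= q by rewrite mulr_ge0 // exprn_ge0 // divr_ge0.
  have -> : D * (9 / 10 * (9 / 10) ^+ k) = 9 / 10 * q by rewrite /q; ring.
  set x := (it k).1 in IH1 *; set y := (it k).2 in IH2 *.
  have h1 : enorm (S y - zs) <= 9 / 10 * q by have := Sc y; lra.
  split=> //.
  have -> : S y + theta *: (S y - x) - zs =
            (S y - zs) + theta *: ((S y - zs) + (zs - x)).
    by rewrite (addrA _ zs) subrK addrAC.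
  apply: le_trans (enorm_triangle _ _) _; rewrite enormZ //.
  have h2 := enorm_triangle (S y - zs) (zs - x); rewrite (enormB zs) in h2.
  have h3 : theta * enorm (S y - zs + (zs - x)) <= 11 / 100 * (9 / 10 * q + q).
    by apply: ler_pM => //; [exact: enorm_ge0 | lra].
  lra.
have Zit k : Z (it k.+1).1 by rewrite itS; exact: proj_in.
have LneqM : (3 * l == 2 * l) = false by apply/eqP; lra.
have outE k : agd_out h Z x0 (3 * l) (2 * l) k = S (it k).1 by [].
have tolE : tau / (2 * (3 * l / (2 * l)) ^+ 2 * (3 * l - 2 * l)) = tau / (9 / 2 * l).
  by rewrite kE; congr (_ / _); field.
have stop : agd_stop h Z x0 (3 * l) (2 * l) tau t.+1.
  rewrite /agd_stop LneqM outE tolE /= -/(it t.+1); set z := (it t.+1).1.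
  rewrite ler_pdivlMr ?mulr_gt0 //.
  have r : enorm (z - S z) <= 5 / 3 * (D * (9 / 10) ^+ t).
    apply: le_trans (resid z) _; rewrite ler_wpM2l ?divr_ge0 //.
    apply: le_trans (rate t.+1).1 _; rewrite exprS mulrCA ler_piMl //.
      by rewrite mulr_ge0 // exprn_ge0 // divr_ge0.
    by rewrite ler_pdivrMr // mul1r ler_nat.
  apply: le_trans ht.
  have {}r : enorm (z - S z) ^+ 2 <= (5 / 3 * (D * (9 / 10) ^+ t)) ^+ 2.
    by rewrite ler_sqr ?nnegrE ?enorm_ge0 // (le_trans (enorm_ge0 _) r).
  apply: le_trans (ler_wpM2r _ r) _; first by rewrite mulr_ge0 // ltW.
  by rewrite le_eqVlt; apply/orP; left; apply/eqP; field.
have [t' [-> st' le]] := agd_someP stop.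
exists (agd_out h Z x0 (3 * l) (2 * l) t'), t'; split => //; first exact: proj_in.
move: st'; rewrite /agd_stop LneqM outE tolE -/(it t'); set z := (it t').1.
case/andP => _ /=; rewrite ler_pdivlMr ?mulr_gt0 // => r; apply: le_trans r.
have r := err z.
have {}r : dotp (S z - zs) (S z - zs) <= (2 * enorm (z - S z)) ^+ 2.
  by rewrite -enorm_le // mulr_ge0 ?enorm_ge0.
rewrite -(ler_pM2l l0) in r; apply: le_trans r _.
have := sqr_ge0 (enorm (z - S z)); set e := _ ^+ 2; rewrite exprMn -/e => e0.
have : 0 <= l * e by rewrite mulr_ge0 // ltW.
lra.
Qed.

End AGDProof.

(** * Partial optimization *)

(** The value function w |-> phi (us w) w of a family of problems whose
    solutions us w have quadratic growth inherits a quadratic lower model: moving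
    to us w' costs at least c / 2 |us w' - us w| ^ 2 at the old parameter, which
    pays for the change of the gradient. *)
Lemma partial_min_lower {R : realType} {m n : nat}
    (phi : 'rV[R]_m -> 'rV[R]_n -> R) (gam : 'rV[R]_m -> 'rV[R]_n -> 'rV[R]_n)
    (u u' : 'rV[R]_m) (w w' : 'rV[R]_n) (l c : R) :
  0 < l -> 0 < c ->
  phi u w + c / 2 * dotp (u' - u) (u' - u) <= phi u' w ->
  phi u' w + dotp (gam u' w) (w' - w) - l / 2 * dotp (w' - w) (w' - w)
    <= phi u' w' ->
  enorm (gam u' w - gam u w) <= l * enorm (u' - u) ->
  phi u w + dotp (gam u w) (w' - w)
    - (l / 2 + l ^+ 2 / (2 * c)) * dotp (w' - w) (w' - w) <= phi u' w'.
Proof.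
move=> l0 c0 growth lower lip; apply: le_trans lower.
have k0 : 0 < c / (2 * l ^+ 2) by rewrite divr_gt0 // mulr_gt0 // exprn_gt0.
set D := w' - w; have := dotp_young (gam u' w - gam u w) D k0.
rewrite dotpDl dotpNl ler_norml => /andP[h _].
have h1 : c / (2 * l ^+ 2) * dotp (gam u' w - gam u w) (gam u' w - gam u w)
          <= c / 2 * dotp (u' - u) (u' - u).
  have -> : c / 2 * dotp (u' - u) (u' - u) =
            c / (2 * l ^+ 2) * (l * enorm (u' - u)) ^+ 2.
    by rewrite exprMn sqr_enorm; field; exact: lt0r_neq0.
  rewrite ler_wpM2l ?(ltW k0) // -enorm_le // mulr_ge0 ?enorm_ge0 //; exact: ltW.
have h2 : dotp D D / (4 * (c / (2 * l ^+ 2))) = l ^+ 2 / (2 * c) * dotp D D.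
  by field; rewrite !lt0r_neq0.
rewrite h2 in h; move: (dotp _ _) (dotp _ _) (dotp _ _) (dotp _ _) (dotp _ _) h h1 growth.
move=> a b c' d e; lra.
Qed.

Section ConcaveMaximizer.
Context {R : realType} {m n : nat}.
Variables (f : 'rV[R]_m -> 'rV[R]_n -> R) (X : set 'rV[R]_m) (Y : set 'rV[R]_n).
Variables (l mu : R).
Hypotheses (fs : jointly_smooth l f) (cY : convex_body Y) (mu0 : 0 < mu) (mul : mu <= l).
Hypothesis concave : forall x, X x -> forall y y',
  f x y' <= f x y + dotp (grad (f x) y) (y' - y) - mu / 2 * dotp (y' - y) (y' - y).

Lemma opp_upper x (k : R) : l <= k -> forall y y',
  - f x y' <= - f x y + dotp (grad (fun v => - f x v) y) (y' - y)
              + k / 2 * dotp (y' - y) (y' - y).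
Proof.
move=> lk y y'; rewrite (grad_oppy fs) dotpNl.
have := taylor_y fs x y y'; rewrite ler_norml => /andP[h _].
have := dotp_ge0 (y' - y) => n0; have := ler_wpM2r n0 lk; lra.
Qed.

Lemma opp_lower x : X x -> forall y y',
  - f x y + dotp (grad (fun v => - f x v) y) (y' - y)
    + mu / 2 * dotp (y' - y) (y' - y) <= - f x y'.
Proof.
by move=> Xx y y'; rewrite (grad_oppy fs) dotpNl; have := concave Xx y y'; lra.
Qed.

Lemma maximizer_exists x :
  exists2 y, Y y & forall y', Y y' -> f x y' <= f x y.
Proof.
have [y Yy ymin] : exists2 y, Y y & forall y', Y y' -> - f x y <= - f x y'.
  apply: (argmin_exists (gr := fun y => - grad (f x) y) (c := l / 2) cY).
  move=> y y' _ _; have := taylor_y fs x y y'; rewrite dotpNl -normrN.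
  by congr (`|_| <= _); ring.
by exists y => // y' Yy'; rewrite -lerN2 ymin.
Qed.

End ConcaveMaximizer.

(** * The procedure Maximin-AG2 *)

Lemma two_thirds_bound {R : realType} (a b c d : R) :
  a <= c + d -> c <= 2 / 3 * a -> d <= 1 / 3 * b -> a <= b.
Proof. lra. Qed.

Lemma opp_model_le {R : realType} (G fy fy' q d n : R) :
  G <= fy' + q -> fy' <= fy + d - n -> - (fy + q) + - d + n <= - G.
Proof. lra. Qed.

Lemma opp_model_ge {R : realType} (G G' d n : R) :
  G + d - n <= G' -> - G' <= - G + - d + n.
Proof. lra. Qed.

Lemma shift_model_le {R : realType} (fy fy' q d n : R) :
  - n <= fy' - fy - d -> fy + q + d - n <= fy' + q.
Proof. lra. Qed.

Lemma absorb_gradient_error {R : realType} (Fp Fz A E1 E2 B C N M l mu : R) :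
  0 < mu -> mu <= l -> 0 <= N -> N <= M ->
  Fp + 9 * l * (A + B) - (E1 + E2) - 2 * l / 2 * B + mu / 2 * C <= Fz ->
  E1 <= 7 / 16 * mu * C + N / (4 * (7 / 16 * mu)) ->
  E2 <= 7 / 2 * l * B + N / (4 * (7 / 2 * l)) ->
  Fp + 9 * l * A + 9 * l / 2 * B + mu / 8 / 2 * C - M / mu <= Fz.
Proof.
move=> mu0 mul N0 NM h h1 h2; have l0 : 0 < l := lt_le_trans mu0 mul.
have E1' : N / (4 * (7 / 16 * mu)) = 4 / 7 * (N / mu).
  by field; exact: lt0r_neq0.
have E2' : N / (4 * (7 / 2 * l)) = 1 / 14 * (N / l).
  by field; exact: lt0r_neq0.
have i1 : N / l <= N / mu by rewrite ler_wpM2l // lef_pV2.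
have i2 : N / mu <= M / mu by rewrite ler_wpM2r // invr_ge0 ltW.
have i3 : 0 <= N / mu by rewrite divr_ge0 // ltW.
rewrite E1' in h1; rewrite E2' in h2; move: i1 i2 i3 h h1 h2.
move: (N / l) (N / mu) (M / mu) => i j k; lra.
Qed.

Lemma residual_le {R : realType} (D d q s e r l tt : R) :
  0 < l -> 0 <= D -> 0 <= d -> 0 <= r ->
  q <= D + (9 * l)^-1 * s -> s <= l * e + l * D -> e <= d + D -> r <= D + q ->
  l * d ^+ 2 <= tt -> l * r ^+ 2 <= 10 * l * D ^+ 2 + tt.
Proof.
move=> l0 D0 d0 r0 hq hs he hr hd.
have l9V : 0 <= (9 * l)^-1 by rewrite invr_ge0 mulr_ge0 // ltW.
have h1 : (9 * l)^-1 * s <= 1 / 9 * (e + D).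
  apply: le_trans (ler_wpM2l l9V hs) _.
  by rewrite le_eqVlt; apply/orP; left; apply/eqP; field; exact: lt0r_neq0.
have h2 : r <= 20 / 9 * D + 1 / 9 * d by lra.
have h3 : r ^+ 2 <= 10 * D ^+ 2 + d ^+ 2.
  apply: (@le_trans _ _ ((20 / 9 * D + 1 / 9 * d) ^+ 2)).
    by rewrite ler_sqr // nnegrE // addr_ge0 ?mulr_ge0 ?divr_ge0.
  have := sqr_ge0 (20 * D - d); have := sqr_ge0 D; have := sqr_ge0 d.
  by rewrite !expr2; lra.
have := ler_wpM2l (ltW l0) h3; lra.
Qed.

(** The constants 9 (l / mu) / 2 = k1 k2 and 45 (l / mu) = 10 k1 k2 of the
    procedure.  The tolerances leave the factor (10 k1 k2)^3 / 3 between the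
    inner precision tt and the outer threshold, and the residual reached by the
    momentum scheme is 361 (l / mu)^3 tt only. *)
Lemma outer_threshold {R : realType} (l mu a tt D2 n r B : R) :
  0 < mu -> mu <= l -> 0 < tt -> 0 < a -> a ^+ 2 * (9 * l) = mu / 8 ->
  0 <= n -> B * (l * D2) <= tt ->
  mu / 2 * n <= B * (9 * l * D2) + l * tt / mu / a ->
  l * r <= 10 * l * n + tt ->
  l * r <= tt * (45 * (l / mu)) ^+ 3 / 3.
Proof.
move=> mu0 mul tt0 a0 aE n0 hB hn hr.
have l0 : 0 < l := lt_le_trans mu0 mul.
set k := l / mu; have k1 : 1 <= k by rewrite ler_pdivlMr // mul1r.
have k0 : 0 < k := lt_le_trans ltr01 k1.
have lE : l = k * mu by rewrite divfK // lt0r_neq0.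
have aV : a^-1 <= 9 * k.
  have a72 : a ^+ 2 = (72 * k)^-1.
    have l90 : 9 * l != 0 by rewrite mulf_neq0 // lt0r_neq0.
    by rewrite -[LHS](mulfK l90) aE /k; field; rewrite !lt0r_neq0.
  have q1 : 0 <= a^-1 by rewrite invr_ge0 ltW.
  have q2 : 0 <= 9 * k by rewrite mulr_ge0 // ltW.
  rewrite -ler_sqr ?nnegrE //.
  rewrite exprVn a72 invrK exprMn expr2 (expr2 k).
  have := ler_wpM2r (ltW k0) k1; lra.
have k2 : k <= k ^+ 2 by rewrite expr2 ler_peMl // ltW.
have k3 : k ^+ 2 <= k ^+ 3 by rewrite exprS ler_peMl ?sqr_ge0.
have h1 : l * tt / mu / a <= 9 * (k ^+ 2 * tt).
  have -> : l * tt / mu / a = k * tt * a^-1 by rewrite /k; field; rewrite !lt0r_neq0.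
  have -> : 9 * (k ^+ 2 * tt) = k * tt * (9 * k) by ring.
  by rewrite ler_wpM2l // mulr_ge0 // ltW.
have h2 : l * n <= 2 * k * (9 * tt + 9 * (k ^+ 2 * tt)).
  have -> : l * n = 2 * k * (mu / 2 * n) by rewrite lE; field.
  apply: ler_wpM2l; first by rewrite mulr_ge0 // ltW.
  apply: le_trans hn _; apply: lerD => //.
  have -> : B * (9 * l * D2) = 9 * (B * (l * D2)) by ring.
  by rewrite ler_wpM2l.
have p1 := ler_wpM2r (ltW tt0) k2; have p2 := ler_wpM2r (ltW tt0) k3.
have p3 := ler_wpM2r (ltW tt0) k1.
have -> : tt * (45 * k) ^+ 3 / 3 = 15 * (45 * (45 * (k ^+ 3 * tt))) by field.
have E : 2 * k * (9 * tt + 9 * (k ^+ 2 * tt)) = 18 * (k * tt) + 18 * (k ^+ 3 * tt).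
  by ring.
rewrite E in h2; move: h2 hr p1 p2 p3; rewrite mul1r -mulrA.
have : 0 <= k ^+ 3 * tt by rewrite mulr_ge0 ?exprn_ge0 // ltW.
move: (k ^+ 3 * tt) (k ^+ 2 * tt) (k * tt) (l * n) (l * r) => a3 a2 a1 ln lr.
clear; lra.
Qed.

Lemma abs_model_le {R : realType} (a b d p q : R) :
  0 <= p -> 0 <= q -> a + d + p <= b -> b <= a + d + q -> `|b - a - d| <= q.
Proof. by move=> *; rewrite ler_norml; apply/andP; split; lra. Qed.

(** Bookkeeping for the stationarity error of the output, with K = 45 l / mu and
    tau = tt K^7.  In units of u = sqrt (tt / l), the solution x has error
    d <= 1 and the residual r is at most K^2, which bounds the distance D to the
    maximizer by 20 (l / mu) K^2; the two gradient errors add up to at most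
    l K^3. *)
Lemma output_error_le {R : realType} (l mu tt K d rho E1 D r' r E2 E : R) :
  K = 45 * (l / mu) -> 0 < mu -> mu <= l -> 0 < tt ->
  0 <= d -> 0 <= r -> 0 <= E ->
  l * d ^+ 2 <= tt -> rho <= 2 * d -> E1 <= (3 * l + 18 * (l / mu) * l) * rho ->
  mu * D <= (9 * l + mu) * r' -> r' <= r + (9 * l)^-1 * (l * rho) ->
  E2 <= l * D -> l * r ^+ 2 <= tt * K ^+ 3 / 3 -> E <= E1 + E2 ->
  E ^+ 2 <= l * (tt * K ^+ 7).
Proof.
move=> KE mu0 mul tt0 d0 r0 E0 hd hrho hE1 hD hr' hE2 hr hE.
have l0 : 0 < l := lt_le_trans mu0 mul.
set k := l / mu in KE hE1 *; have k1 : 1 <= k by rewrite ler_pdivlMr // mul1r.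
have k0 : 0 < k := lt_le_trans ltr01 k1.
have lE : l = k * mu by rewrite divfK // lt0r_neq0.
have K45 : 45 <= K by rewrite KE; lra.
have K0 : 0 < K by rewrite KE mulr_gt0.
pose u := Num.sqrt (tt / l).
have u0 : 0 <= u := sqrtr_ge0 _.
have uE : tt = l * u ^+ 2.
  by rewrite sqr_sqrtr ?divr_ge0 ?(ltW tt0) ?(ltW l0) // mulrC divfK // lt0r_neq0.
have du : d <= u by move: hd; rewrite uE (ler_pM2l l0) ler_sqr.
have K1 : 1 <= K by lra.
have K2 : 1 <= K ^+ 2 by rewrite exprn_ege1.
have ru : r <= u * K ^+ 2.
  have uK : 0 <= u * K ^+ 2 by rewrite mulr_ge0 ?sqr_ge0.
  rewrite -ler_sqr ?nnegrE // -(ler_pM2l l0); apply: le_trans hr _.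
  have -> : l * (u * K ^+ 2) ^+ 2 = tt * K ^+ 3 * K by rewrite uE; ring.
  by rewrite ler_wpM2l ?mulr_ge0 ?exprn_ge0 ?(ltW tt0) ?(ltW K0) //; lra.
have {}hr' : r' <= 2 * (u * K ^+ 2).
  have E9 : (9 * l)^-1 * (l * rho) = 1 / 9 * rho by field; exact: lt0r_neq0.
  rewrite E9 in hr'; have := ler_wpM2l u0 K2; rewrite mulr1.
  by move: hr' hrho du ru; move: (u * K ^+ 2) => v; lra.
have {}hD : D <= 20 * (k * (u * K ^+ 2)).
  rewrite -(ler_pM2l mu0); apply: le_trans hD _.
  have uK : 0 <= u * K ^+ 2 by rewrite mulr_ge0 ?sqr_ge0.
  apply: (@le_trans _ _ ((10 * l) * (2 * (u * K ^+ 2)))); last first.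
    by rewrite lE le_eqVlt; apply/orP; left; apply/eqP; ring.
  apply: (@le_trans _ _ ((9 * l + mu) * (2 * (u * K ^+ 2)))).
    by apply: ler_wpM2l hr'; apply: ltW; rewrite addr_gt0 // mulr_gt0.
  by rewrite ler_wpM2r ?mulr_ge0 //; lra.
have {}hE1 : E1 <= l * (42 * (k * u)).
  apply: le_trans hE1 _.
  apply: (@le_trans _ _ ((3 * l + 18 * k * l) * (2 * u))).
    apply: ler_wpM2l; last by lra.
    apply: ltW; apply: addr_gt0; first exact: mulr_gt0.
    by apply: mulr_gt0 => //; exact: mulr_gt0.
  have := ler_wpM2l (mulr_ge0 (ltW l0) u0) k1; lra.
have hE' : E <= l * (u * K ^+ 3).
  apply: le_trans hE _.
  have h : E2 <= l * (20 * (k * (u * K ^+ 2))).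
    by apply: le_trans hE2 _; rewrite ler_pM2l.
  have kE : k = K / 45 by rewrite KE; field.
  have p1 : 0 <= l * u by rewrite mulr_ge0 // ltW.
  have p2 : l * u * K <= l * u * K ^+ 3.
    by rewrite ler_wpM2l // exprS ler_peMr // ltW.
  have p3 : 0 <= l * u * K by rewrite mulr_ge0 // ltW.
  move: h hE1; rewrite kE.
  have -> : l * (20 * (K / 45 * (u * K ^+ 2))) = 20 / 45 * (l * u * K ^+ 3) by field.
  have -> : l * (42 * (K / 45 * u)) = 42 / 45 * (l * u * K) by field.
  have -> : l * (u * K ^+ 3) = l * u * K ^+ 3 by ring.
  have p4 : 45 * (l * u * K) <= l * u * K ^+ 3.
    have -> : l * u * K ^+ 3 = K ^+ 2 * (l * u * K) by ring.
    rewrite ler_wpM2r //; apply: le_trans K45 _.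
    by rewrite expr2 ler_peMl // ltW.
  move: p2 p3 p4; move: (l * u * K) (l * u * K ^+ 3) => v w; lra.
have {}hE' : E ^+ 2 <= (l * (u * K ^+ 3)) ^+ 2.
  by rewrite ler_sqr // nnegrE // (le_trans E0 hE').
apply: le_trans hE' _.
have -> : (l * (u * K ^+ 3)) ^+ 2 = l * tt * K ^+ 6 by rewrite uE; ring.
have -> : l * (tt * K ^+ 7) = l * tt * K ^+ 6 * K by ring.
by rewrite ler_peMr // mulr_ge0 ?exprn_ge0 ?mulr_ge0 // ltW.
Qed.

Section ProxStep.
Context {R : realType} {m n : nat}.
Variables (f : 'rV[R]_m -> 'rV[R]_n -> R) (X : set 'rV[R]_m) (Y : set 'rV[R]_n).
Variables (l mu : R) (xc : 'rV[R]_m).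
Hypotheses (fs : jointly_smooth l f) (cX : convex_body X) (cY : convex_body Y).
Hypotheses (mu0 : 0 < mu) (mul : mu <= l).
Hypothesis concave : forall x, X x -> forall y y',
  f x y' <= f x y + dotp (grad (f x) y) (y' - y) - mu / 2 * dotp (y' - y) (y' - y).

Let l0 : 0 < l. Proof. exact: (lt_le_trans mu0 mul). Qed.

Let g x y : R := f x y + l * enorm (x - xc) ^+ 2.
Let gx x y := grad (f^~ y) x + (2 * l) *: (x - xc).
Let gy x y := grad (f x) y.

Lemma prox_gradx x y : grad (g^~ y) x = gx x y.
Proof. exact: (grad_prox fs xc x y l). Qed.

Lemma prox_grady x y : grad (g x) y = gy x y.
Proof.
apply/rowP => i; rewrite !mxE /derive; set e := delta_mx 0 i.
have -> // : (fun k : R => k^-1 *: ((g x \o shift y) (k *: e) - g x y)) =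
             (fun k : R => k^-1 *: ((f x \o shift y) (k *: e) - f x y)).
by apply/funext => k /=; rewrite /g opprD addrACA subrr addr0.
Qed.

(** The proximal term makes a gradient step along x nonexpansive, whether or
    not f is convex in x: the Lipschitz constant is |1 - 2ls| + ls. *)
Lemma prox_step_lip s x x' y : 0 <= s -> 2 * l * s <= 1 ->
  enorm ((x - s *: gx x y) - (x' - s *: gx x' y)) <= (1 - l * s) * enorm (x - x').
Proof.
move=> s0 ls.
have -> : (x - s *: gx x y) - (x' - s *: gx x' y) =
  (1 - 2 * l * s) *: (x - x') - s *: (grad (f^~ y) x - grad (f^~ y) x').
  by apply/rowP => i; rewrite /gx !mxE; ring.
apply: le_trans (enorm_triangle _ _) _.
rewrite enormN enormZ ?subr_ge0 // enormZ //.
have := ler_wpM2l s0 (lip_xx fs x x' y); lra.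
Qed.

Lemma gx_lip x x' y : enorm (gx x y - gx x' y) <= 3 * l * enorm (x - x').
Proof.
have -> : gx x y - gx x' y =
  (grad (f^~ y) x - grad (f^~ y) x') + (2 * l) *: (x - x').
  by apply/rowP => i; rewrite /gx !mxE; ring.
apply: le_trans (enorm_triangle _ _) _; rewrite enormZ ?mulr_ge0 ?(ltW l0) //.
have := lip_xx fs x x' y; lra.
Qed.

Let g_lower x x' y :
  g x y + dotp (gx x y) (x' - x) + l / 2 * dotp (x' - x) (x' - x) <= g x' y.
Proof.
have := taylor_x fs x x' y; rewrite ler_norml => /andP[h _]; move: h.
rewrite /g /gx !sqr_enorm (dotpDl (grad (f^~ y) x)) dotpZl.
move: (dotp (grad _ _) _) => e.
have -> : dotp (x' - xc) (x' - xc) = dotp (x - xc) (x - xc)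
   + 2 * dotp (x - xc) (x' - x) + dotp (x' - x) (x' - x) by dotp_expand; ring.
lra.
Qed.

Let g_upper x x' y :
  g x' y <= g x y + dotp (gx x y) (x' - x) + 3 * l / 2 * dotp (x' - x) (x' - x).
Proof.
have := taylor_x fs x x' y; rewrite ler_norml => /andP[_ h]; move: h.
rewrite /g /gx !sqr_enorm (dotpDl (grad (f^~ y) x)) dotpZl.
move: (dotp (grad _ _) _) => e.
have -> : dotp (x' - xc) (x' - xc) = dotp (x - xc) (x - xc)
   + 2 * dotp (x - xc) (x' - x) + dotp (x' - x) (x' - x) by dotp_expand; ring.
lra.
Qed.

(** The inner solution map is defined for every y, including the extrapolated
    points outside Y. *)
Lemma inner_solution : exists xs : 'rV[R]_n -> 'rV[R]_m,
  [/\ forall y, X (xs y),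
      forall y x, X x -> 0 <= dotp (gx (xs y) y) (x - xs y),
      forall y x, X x -> g (xs y) y + l / 2 * dotp (x - xs y) (x - xs y) <= g x y
    & forall y y', enorm (xs y - xs y') <= enorm (y - y')].
Proof.
have /choice[xs xsP] y : exists x, X x /\ forall x', X x' -> g x y <= g x' y.
  have [x Xx xmin] : exists2 x, X x & forall x', X x' -> g x y <= g x' y.
    apply: (argmin_exists (gr := gx^~ y) (c := 3 * l / 2) cX) => x x' _ _.
    have := g_lower x x' y; have := g_upper x x' y.
    have : 0 <= l * dotp (x' - x) (x' - x) by rewrite mulr_ge0 ?dotp_ge0 // ltW.
    move: (g x y) (g x' y) (dotp (gx _ _) _) (dotp _ _) => a b c d *.
    by rewrite ler_norml; apply/andP; split; lra.
  by exists x.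
have c0 : 0 <= 3 * l / 2 by rewrite divr_ge0 // mulr_ge0 // ltW.
have vi y x : X x -> 0 <= dotp (gx (xs y) y) (x - xs y).
  by apply: (minimizer_first_order (h := g^~ y) cX c0 (xsP y).1) => z;
    [move=> _; exact: g_upper | exact: (xsP y).2].
exists xs; split => //.
- by move=> y; exact: (xsP y).1.
- move=> y x Xx; apply: le_trans (g_lower (xs y) x y).
  by rewrite lerD2r lerDl vi.
- move=> y y'.
  have l30 : 0 < 3 * l by rewrite mulr_gt0.
  have E1 := fixed_pointP cX l30 (xsP y).1 (vi y).
  have E2 := fixed_pointP cX l30 (xsP y').1 (vi y').
  have h : enorm (xs y - xs y') <=
      enorm ((xs y - (3 * l)^-1 *: gx (xs y) y) - (xs y' - (3 * l)^-1 *: gx (xs y') y')).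
    by rewrite -{1}E1 -{1}E2; exact: proj_nonexpansive.
  have s0 : 0 <= (3 * l)^-1 by rewrite invr_ge0 ltW.
  have sl : 2 * l * (3 * l)^-1 <= 1.
    by rewrite ler_pdivrMr // mul1r ler_pM2r // ler_nat.
  have h1 := prox_step_lip (xs y) (xs y') y s0 sl.
  have h2 : enorm ((3 * l)^-1 *: (gx (xs y') y - gx (xs y') y')) <=
            (3 * l)^-1 * (l * enorm (y - y')).
    rewrite enormZ // ler_wpM2l //.
    have -> : gx (xs y') y - gx (xs y') y' =
              grad (f^~ y) (xs y') - grad (f^~ y') (xs y').
      by rewrite /gx opprD addrACA subrr addr0.
    exact: lip_xy.
  have h3 := enorm_triangle ((xs y - (3 * l)^-1 *: gx (xs y) y)
    - (xs y' - (3 * l)^-1 *: gx (xs y') y))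
    (- ((3 * l)^-1 *: (gx (xs y') y - gx (xs y') y'))).
  have E : (xs y - (3 * l)^-1 *: gx (xs y) y) - (xs y' - (3 * l)^-1 *: gx (xs y') y)
     - (3 * l)^-1 *: (gx (xs y') y - gx (xs y') y') =
     (xs y - (3 * l)^-1 *: gx (xs y) y) - (xs y' - (3 * l)^-1 *: gx (xs y') y').
    move: (gx (xs y) y) (gx (xs y') y) (gx (xs y') y') => p q r.
    by apply/rowP => i; rewrite !mxE; ring.
  rewrite E enormN in h3.
  have E3 : (3 * l)^-1 * (l * enorm (y - y')) = 1 / 3 * enorm (y - y').
    by field; exact: lt0r_neq0.
  have E4 : 1 - l * (3 * l)^-1 = 2 / 3 by field; exact: lt0r_neq0.
  rewrite E4 in h1; rewrite E3 in h2.
  exact: two_thirds_bound (le_trans h h3) h1 h2.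
Qed.


Variable xs : 'rV[R]_n -> 'rV[R]_m.
Hypothesis Xxs : forall y, X (xs y).
Hypothesis xs_vi : forall y x, X x -> 0 <= dotp (gx (xs y) y) (x - xs y).
Hypothesis xs_growth : forall y x, X x ->
  g (xs y) y + l / 2 * dotp (x - xs y) (x - xs y) <= g x y.
Hypothesis xs_lip : forall y y', enorm (xs y - xs y') <= enorm (y - y').

Let F y := - g (xs y) y.

Let F_lower y y' : F y + dotp (- gy (xs y) y) (y' - y)
  + mu / 2 * dotp (y' - y) (y' - y) <= F y'.
Proof.
have h1 := concave (Xxs y) y y'.
have h2 : g (xs y') y' <= g (xs y) y'.
  apply: le_trans (xs_growth y' (Xxs y)); rewrite lerDl mulr_ge0 ?dotp_ge0 //.
  by rewrite divr_ge0 // ltW.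
by rewrite dotpNl; exact: opp_model_le h2 h1.
Qed.

Let F_upper y y' : F y' <= F y + dotp (- gy (xs y) y) (y' - y)
  + 2 * l / 2 * dotp (y' - y) (y' - y).
Proof.
have h0 : g (xs y') y + dotp (gy (xs y') y) (y' - y) - l / 2 * dotp (y' - y) (y' - y)
          <= g (xs y') y'.
  have := taylor_y fs (xs y') y y'; rewrite ler_norml => /andP[h _].
  exact: shift_model_le h.
have := partial_min_lower (phi := g) (gam := gy) l0 l0 (xs_growth y (Xxs y')) h0
  (lip_yx fs (xs y') (xs y) y).
rewrite (_ : l / 2 + l ^+ 2 / (2 * l) = 2 * l / 2); last by field; exact: lt0r_neq0.
by rewrite dotpNl => h; exact: opp_model_ge h.
Qed.

Variables (x0 : 'rV[R]_m) (y0 : 'rV[R]_n) (Xx0 : X x0) (Yy0 : Y y0).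

Lemma inner_agd tt t :
  25 / 2 * ((9 / 10) ^+ t) ^+ 2 * (l * diameter X ^+ 2) <= tt ->
  forall y, exists out t', [/\ agd (g^~ y) X x0 (3 * l) (2 * l) tt = Some (out, 2 * t')%N,
    (t' <= t.+1)%N, X out & l * dotp (out - xs y) (out - xs y) <= tt].
Proof.
move=> ht y; apply: (agd_contracts cX Xx0 l0 _ (Xxs y) _ _ ht).
- move=> w w'; rewrite !prox_gradx.
  have s0 : 0 <= (3 * l)^-1 by rewrite invr_ge0 mulr_ge0 // ltW.
  have sl : 2 * l * (3 * l)^-1 <= 1.
    by rewrite ler_pdivrMr ?mulr_gt0 // mul1r ler_pM2r // ler_nat.
  have := prox_step_lip w w' y s0 sl.
  by rewrite (_ : 1 - l * (3 * l)^-1 = 2 / 3) //; field; exact: lt0r_neq0.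
- by move=> z Xz; rewrite prox_gradx; exact: xs_vi.
- exact: diameter_ge.
Qed.


Section OuterLoop.
Variables (tt : R) (xo : 'rV[R]_n -> 'rV[R]_m).
Hypothesis tt0 : 0 < tt.
Hypothesis xo_close : forall y, l * dotp (xo y - xs y) (xo y - xs y) <= tt.

Let S w := proj Y (w + (9 * l)^-1 *: gy (xo w) w).

Let l90 : 0 < 9 * l. Proof. by rewrite mulr_gt0. Qed.

Let SE w : S w = proj Y (w - (9 * l)^-1 *: - gy (xo w) w).
Proof. by rewrite /S scalerN opprK. Qed.

(* The step 1 / (9l) is shorter than the 2l-smoothness of F requires; this slack
   and 7/8 of the strong convexity absorb the error of the inner solver. *)
Let outer_step_lower w z : Y z ->
  F (S w) + 9 * l * dotp (w - S w) (z - w) + 9 * l / 2 * dotp (w - S w) (w - S w)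
    + mu / 8 / 2 * dotp (z - w) (z - w) - l * tt / mu <= F z.
Proof.
move=> Yz.
have h := proj_gradient_lower cY l90 Yz (SE w) (F_upper w (S w)) (F_lower w z).
set err := - gy (xo w) w - - gy (xs w) w in h.
have errN : dotp err err <= l * tt.
  rewrite -sqr_enorm /err opprK addrC.
  have e0 := enorm_ge0 (gy (xs w) w - gy (xo w) w).
  apply: (@le_trans _ _ ((l * enorm (xs w - xo w)) ^+ 2)).
    by rewrite ler_sqr ?nnegrE // ?mulr_ge0 ?enorm_ge0 ?(ltW l0) // (lip_yx fs).
  rewrite exprMn enormB sqr_enorm expr2 -mulrA.
  by rewrite (ler_pM2l l0); exact: xo_close.
have c1 : 0 < 7 / 16 * mu by rewrite mulr_gt0 ?divr_gt0.
have c2 : 0 < 7 / 2 * l by rewrite mulr_gt0 ?divr_gt0.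
have := dotp_young (z - w) err c1; rewrite ler_norml => /andP[_ h1].
have := dotp_young (w - S w) err c2; rewrite ler_norml => /andP[_ h2].
apply: (absorb_gradient_error mu0 mul (dotp_ge0 err) errN _ h1 h2).
rewrite -dotpDl addrA subrK [dotp (z - S w) err]dotpC.
by rewrite -dotpDr addrA subrK.
Qed.

Variables (ys : 'rV[R]_n) (Yys : Y ys).
Hypothesis ys_min : forall y, Y y -> F ys <= F y.

Let ys_vi y : Y y -> 0 <= dotp (- gy (xs ys) ys) (y - ys).
Proof.
have c0 : 0 <= 2 * l / 2 by rewrite divr_ge0 // mulr_ge0 // ltW.
exact: (minimizer_first_order cY c0 Yys (fun y _ => F_upper ys y) ys_min).
Qed.

Let ys_growth y : Y y -> F ys + mu / 2 * dotp (y - ys) (y - ys) <= F y.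
Proof.
move=> Yy; apply: le_trans (F_lower ys y).
by rewrite lerD2r lerDl ys_vi.
Qed.

Lemma outer_rate a t y : 0 < a -> a <= 1 -> a ^+ 2 * (9 * l) = mu / 8 ->
  y = (momentum S ((1 - a) / (1 + a)) y0 t.+1).1 ->
  mu / 2 * dotp (y - ys) (y - ys) <=
    (1 - a) ^+ t * (9 * l * diameter Y ^+ 2) + l * tt / mu / a.
Proof.
move=> a0 a1 aE ->.
have e0 : 0 <= l * tt / mu by rewrite divr_ge0 ?mulr_ge0 // ltW.
have SY w : Y (S w) by exact: proj_in.
have diam z z' : Y z -> Y z' -> dotp (z - z') (z - z') <= diameter Y ^+ 2.
  move=> Yz Yz'; rewrite -enorm_le; first exact: diameter_ge.
  by apply: le_trans (diameter_ge cY Yz Yz'); exact: enorm_ge0.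
have lower w z : Y z -> F (S w) + 9 * l * dotp (w - S w) (z - w)
    + 9 * l / 2 * dotp (w - S w) (w - S w)
    + a ^+ 2 * (9 * l) / 2 * dotp (z - w) (z - w) - l * tt / mu <= F z.
  by rewrite aE; exact: outer_step_lower.
have := momentum_rate l90 a0 a1 e0 Yy0 Yys SY diam lower t.
apply: le_trans; rewrite lerBrDl; apply: ys_growth.
exact: (momentum_in Yy0 SY).
Qed.

Lemma outer_residual y : Y y ->
  l * enorm (y - proj Y (y + (9 * l)^-1 *: gy (xo y) y)) ^+ 2
    <= 10 * l * dotp (y - ys) (y - ys) + tt.
Proof.
move=> Yy; set p := proj Y _.
have l9V : 0 <= (9 * l)^-1 by rewrite invr_ge0 ltW.
have E : proj Y (ys + (9 * l)^-1 *: gy (xs ys) ys) = ys.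
  have := fixed_pointP cY l90 Yys ys_vi.
  by rewrite scalerN opprK.
have h1 : enorm (p - ys) <=
    enorm ((y - ys) + (9 * l)^-1 *: (gy (xo y) y - gy (xs ys) ys)).
  rewrite -{1}E; apply: le_trans (proj_nonexpansive cY _ _) _.
  by rewrite scalerBr addrACA opprD.
have {}h1 := le_trans h1 (enorm_triangle _ _).
rewrite enormZ // in h1.
have h2 : enorm (gy (xo y) y - gy (xs ys) ys) <=
          l * enorm (xo y - xs ys) + l * enorm (y - ys).
  have := enorm_triangle (gy (xo y) y - gy (xs ys) y) (gy (xs ys) y - gy (xs ys) ys).
  rewrite addrA subrK => /le_trans; apply; apply: lerD; first exact: (lip_yx fs).
  exact: (lip_yy fs).
have h3 : enorm (xo y - xs ys) <= enorm (xo y - xs y) + enorm (y - ys).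
  have := enorm_triangle (xo y - xs y) (xs y - xs ys); rewrite addrA subrK.
  by move=> /le_trans; apply; rewrite lerD2l xs_lip.
have h4 := enorm_triangle (y - ys) (ys - p).
rewrite addrA subrK (enormB ys) in h4.
rewrite -(sqr_enorm (y - ys)).
apply: (residual_le l0 (enorm_ge0 _) (enorm_ge0 _) (enorm_ge0 _) h1 h2 h3 h4).
by rewrite sqr_enorm.
Qed.

End OuterLoop.


Section Stopping.
Variables (tau : R) (t tin : nat).
Hypothesis tau0 : 0 < tau.
Let k1 : R := 3 * l / (2 * l).
Let k2 : R := 3 * l / mu.
Let tt : R := tau / (10 * k1 * k2) ^+ 7.
Hypothesis tin_large :
  25 / 2 * ((9 / 10) ^+ tin) ^+ 2 * (l * diameter X ^+ 2) <= tt.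
Hypothesis t_large :
  (1 - (4 * Num.sqrt (k1 * k2))^-1) ^+ t * (l * diameter Y ^+ 2) <= tt.

Let k12E : 10 * k1 * k2 = 45 * (l / mu).
Proof. by rewrite /k1 /k2; field; rewrite !lt0r_neq0. Qed.

Let K0 : 0 < 45 * (l / mu).
Proof. by rewrite mulr_gt0 // divr_gt0. Qed.

Let tt0 : 0 < tt.
Proof. by rewrite /tt k12E divr_gt0 // exprn_gt0. Qed.

Lemma ag2_stops : exists t' y yt x N,
  [/\ first_index (ag2_stop g X Y x0 y0 (3 * l) (2 * l) mu tau) = Some t',
      ag2_iter g X Y x0 y0 (3 * l) (2 * l) mu tau t' = Some (y, yt, x, N),
      (N <= t.+1 * (4 * tin + 6))%N &
      [/\ Y y, X x, l * dotp (x - xs y) (x - xs y) <= tt &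
          l * enorm (y - proj Y (y + (9 * l)^-1 *: gy x y)) ^+ 2
            <= tt * (45 * (l / mu)) ^+ 3 / 3]].
Proof.
have /choice[xo' xoP] : forall y, exists p : 'rV[R]_m * nat,
    [/\ agd (g^~ y) X x0 (3 * l) (2 * l) tt = Some (p.1, 2 * p.2)%N,
      (p.2 <= tin.+1)%N, X p.1 & l * dotp (p.1 - xs y) (p.1 - xs y) <= tt].
  by move=> y; have [out [t' h]] := inner_agd tin_large y; exists (out, t').
pose xo y := (xo' y).1.
pose S w := proj Y (w + (9 * l)^-1 *: gy (xo w) w).
pose s : R := 4 * Num.sqrt (k1 * k2).
pose it := momentum S ((s - 1) / (s + 1)) y0.
have etaE : (2 * k1 * (3 * l))^-1 = (9 * l)^-1.
  by rewrite /k1; congr (_^-1); field; exact: lt0r_neq0.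
have iterE j : exists x N, [/\
    ag2_iter g X Y x0 y0 (3 * l) (2 * l) mu tau j = Some ((it j).1, (it j).2, x, N),
    (N <= j * (4 * tin + 6))%N & (0 < j)%N -> x = xo (it j).1].
  elim: j => [|j [x [N [E hN hx]]]]; first by exists x0, 0%N.
  have [A1 A2 _ _] := xoP (it j).2.
  have [B1 B2 _ _] := xoP (it j.+1).1.
  exists (xo (it j.+1).1).
  exists (N + 2 * (xo' (it j).2).2 + 1 + 2 * (xo' (it j.+1).1).2 + 1)%N.
  split => //; last by move: hN A2 B2; rewrite mulSn; clear; lia.
  rewrite /ag2_iter iterS -/(ag2_iter _ _ _ _ _ _ _ _ _ _) E /= -/k1 -/k2 -/tt A1 /=.
  rewrite prox_grady etaE.
  have B1' : agd (g^~ (S (it j).2)) X x0 (3 * l) (2 * l) tt =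
    Some (xo (S (it j).2), 2 * (xo' (S (it j).2)).2)%N by exact: B1.
  by rewrite -/(xo (it j).2) -/(S (it j).2) B1'.
have k1_ge1 : 1 <= l / mu by rewrite ler_pdivlMr // mul1r.
have kk : k1 * k2 = 9 / 2 * (l / mu) by rewrite /k1 /k2; field; rewrite !lt0r_neq0.
have s1 : 1 <= s.
  have : 1 <= Num.sqrt (k1 * k2) by rewrite -{1}sqrtr1 ler_wsqrtr // kk; lra.
  by rewrite /s; lra.
have s0 : 0 < s := lt_le_trans ltr01 s1.
have sE : s ^+ 2 = 72 * (l / mu).
  rewrite /s exprMn sqr_sqrtr kk; last by rewrite mulr_ge0 ?divr_ge0 // ltW.
  by field; exact: lt0r_neq0.
have a0 : 0 < s^-1 by rewrite invr_gt0.
have a1 : s^-1 <= 1 by rewrite invf_le1.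
have aE : s^-1 ^+ 2 * (9 * l) = mu / 8.
  by rewrite exprVn sE; field; rewrite !lt0r_neq0.
have xo_in y : X (xo y) by have [] := xoP y.
have xo_close y : l * dotp (xo y - xs y) (xo y - xs y) <= tt by have [] := xoP y.
have [ys Yys ys_min] : exists2 y, Y y & forall y', Y y' -> F y <= F y'.
  apply: (argmin_exists (gr := fun y => - gy (xs y) y) (c := l) cY) => y y' _ _.
  have muD : 0 <= mu / 2 * dotp (y' - y) (y' - y).
    by rewrite mulr_ge0 ?dotp_ge0 // divr_ge0 // ltW.
  have lD : 0 <= l * dotp (y' - y) (y' - y) by rewrite mulr_ge0 ?dotp_ge0 // ltW.
  have u := F_upper y y'; rewrite (_ : 2 * l / 2 = l) in u; last by field.
  exact: abs_model_le muD lD (F_lower y y') u.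
have Yit j : Y (it j).1 by apply: momentum_in => // w; exact: proj_in.
have thrE : tau / ((10 * k1 * k2) ^+ 4 * (3 * l)) = tt * (45 * (l / mu)) ^+ 3 / 3 / l.
  rewrite /tt k12E; move: (45 * _) K0 => K Kpos.
  by field; rewrite !lt0r_neq0.
have stopE j : (0 < j)%N -> ag2_stop g X Y x0 y0 (3 * l) (2 * l) mu tau j =
  (l * enorm ((it j).1 - proj Y ((it j).1 + (9 * l)^-1 *: gy (xo (it j).1) (it j).1)) ^+ 2
    <= tt * (45 * (l / mu)) ^+ 3 / 3).
  move=> j0; have [x [N [E _ hx]]] := iterE j.
  rewrite /ag2_stop j0 E -/k1 -/k2 thrE etaE prox_grady hx // /=.
  by rewrite ler_pdivlMr // mulrC.
have stop : ag2_stop g X Y x0 y0 (3 * l) (2 * l) mu tau t.+1.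
  rewrite stopE //.
  have rate := outer_rate tt0 xo_close Yys ys_min (t := t) a0 a1 aE (erefl _).
  rewrite -momentum_weightE // -/S -/(it t.+1) in rate.
  have res := outer_residual xo_close Yys ys_min (Yit t.+1).
  exact: (outer_threshold mu0 mul tt0 a0 aE (dotp_ge0 _) t_large rate res).
have [t' [E st' le]] := first_indexP stop.
have [x [N [itE hN hx]]] := iterE t'.
have t'0 : (0 < t')%N by case/andP: st'.
have xE := hx t'0; rewrite stopE // in st'.
have hN' : (N <= t.+1 * (4 * tin + 6))%N.
  by apply: leq_trans hN _; rewrite leq_mul2r le orbT.
rewrite xE in itE *.
exists t', (it t').1, (it t').2, (xo (it t').1), N.
apply: And4 E itE hN' _.
by apply: And4 (Yit t') (xo_in _) (xo_close _) st'.
Qed.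



(** One projected step along x turns the approximate pair (x, y) into an exact
    solution of the inner problem up to a small linear perturbation e.  Unlike a
    bound on the distance to the solution, this is a first-order statement, and
    it controls function values on X. *)
Lemma ag2_output y x xh : Y y -> X x ->
  l * dotp (x - xs y) (x - xs y) <= tt ->
  l * enorm (y - proj Y (y + (9 * l)^-1 *: gy x y)) ^+ 2
    <= tt * (45 * (l / mu)) ^+ 3 / 3 ->
  xh = proj X (x - (18 * (l / mu) * l)^-1 *: gx x y) ->
  exists e yh, [/\ Y yh, forall y', Y y' -> f xh y' <= f xh yh, dotp e e <= l * tau &
    forall z, X z -> 0 <= dotp (gx xh yh - e) (z - xh)].
Proof.
move=> Yy Xx xclose res xhE.
set c := 18 * (l / mu) * l in xhE *.
have c0 : 0 < c by rewrite !mulr_gt0 // invr_gt0.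
have Xxh : X xh by rewrite xhE; exact: proj_in.
have [yh Yyh yh_max] := maximizer_exists fs cY xh.
pose e1 := gx xh y - gx x y + c *: (x - xh).
pose e2 := gx xh yh - gx xh y.
exists (e1 + e2), yh; split => //; last first.
  move=> z Xz; have := proj_gradient_vi cX c0 Xz xhE.
  have -> : gx xh yh - (e1 + e2) = gx x y - c *: (x - xh).
    rewrite /e1 /e2; move: (gx xh yh) (gx xh y) (gx x y) => p q r.
    by apply/rowP => i; rewrite !mxE; ring.
  by rewrite (dotpDl (gx x y)) dotpNl dotpZl subr_ge0.
have K7 : tau = tt * (45 * (l / mu)) ^+ 7.
  by rewrite /tt k12E divfK // lt0r_neq0 // exprn_gt0.
rewrite -sqr_enorm K7.
have h1 : enorm (x - xh) <= 2 * enorm (x - xs y).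
  have E : proj X (xs y - c^-1 *: gx (xs y) y) = xs y.
    by apply: fixed_pointP => // z Xz; exact: xs_vi.
  have s0 : 0 <= c^-1 by rewrite invr_ge0 ltW.
  have s1 : 2 * l * c^-1 <= 1.
    rewrite ler_pdivrMr // mul1r /c ler_wpM2r ?(ltW l0) //.
    have : 1 <= l / mu by rewrite ler_pdivlMr // mul1r.
    by move: (l / mu) => k; lra.
  have h : enorm (xh - xs y) <= enorm (x - xs y).
    rewrite xhE -{1}E; apply: le_trans (proj_nonexpansive cX _ _) _.
    apply: le_trans (prox_step_lip x (xs y) y s0 s1) _.
    by rewrite ler_piMl ?enorm_ge0 // gerDl oppr_le0 mulr_ge0 // ltW.
  have := enorm_triangle (x - xs y) (xs y - xh); rewrite addrA subrK (enormB (xs y)).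
  move=> /le_trans; apply; rewrite mulr_natl mulr2n lerD2l //.
have h2 : enorm e1 <= (3 * l + c) * enorm (x - xh).
  rewrite mulrDl; apply: le_trans (enorm_triangle _ _) _; apply: lerD.
    by rewrite (enormB x); exact: gx_lip.
  by rewrite enormZ // ltW.
have h3 : enorm e2 <= l * enorm (y - yh).
  have -> : e2 = grad (f^~ yh) xh - grad (f^~ y) xh.
    by rewrite /e2 /gx opprD addrACA subrr addr0.
  by rewrite (enormB y); exact: (lip_xy fs).
have l9 : l <= 9 * l by rewrite ler_peMl ?(ltW l0) // ler1n.
have m9 : mu <= 9 * l by exact: le_trans mul l9.
have yh_min y' : Y y' -> - f xh yh <= - f xh y' by move=> Yy'; rewrite lerN2 yh_max.
have h4 := exact_step_error_bound cY mu0 m9 (opp_upper fs xh l9)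
  (opp_lower fs concave Xxh) Yyh yh_min y.
rewrite (grad_oppy fs) scalerN opprK in h4.
have h5 : enorm (y - proj Y (y + (9 * l)^-1 *: gy xh y)) <=
    enorm (y - proj Y (y + (9 * l)^-1 *: gy x y)) + (9 * l)^-1 * (l * enorm (x - xh)).
  have := enorm_triangle (y - proj Y (y + (9 * l)^-1 *: gy x y))
    (proj Y (y + (9 * l)^-1 *: gy x y) - proj Y (y + (9 * l)^-1 *: gy xh y)).
  rewrite addrA subrK => /le_trans; apply; rewrite lerD2l.
  apply: le_trans (proj_nonexpansive cY _ _) _.
  have -> : y + (9 * l)^-1 *: gy x y - (y + (9 * l)^-1 *: gy xh y) =
            (9 * l)^-1 *: (gy x y - gy xh y).
    by rewrite opprD addrACA subrr add0r scalerBr.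
  have l9V : 0 <= (9 * l)^-1 by rewrite invr_ge0 mulr_ge0 // ltW.
  by rewrite enormZ // ler_wpM2l // (lip_yx fs).
rewrite -sqr_enorm in xclose.
exact: (output_error_le (erefl _) mu0 mul tt0 (enorm_ge0 _) (enorm_ge0 _) (enorm_ge0 _)
  xclose h1 h2 h4 h5 h3 res (enorm_triangle e1 e2)).
Qed.

End Stopping.
End ProxStep.

Section MaximinAG2.
Context {R : realType} {m n : nat}.
Variables (f : 'rV[R]_m -> 'rV[R]_n -> R) (X : set 'rV[R]_m) (Y : set 'rV[R]_n).
Variables (l mu : R).
Hypotheses (fs : jointly_smooth l f) (cX : convex_body X) (cY : convex_body Y).
Hypotheses (mu0 : 0 < mu) (mul : mu <= l).
Hypothesis concave : forall x, X x -> forall y y',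
  f x y' <= f x y + dotp (grad (f x) y) (y' - y) - mu / 2 * dotp (y' - y) (y' - y).

(** Maximin-AG2 is an inexact proximal step for x |-> max_Y f x: the error is a
    perturbation e of the optimality condition, uniformly in the center xc. *)
Lemma maximin_ag2_converges xc x0 y0 tau t tin :
  X x0 -> Y y0 -> 0 < tau ->
  25 / 2 * ((9 / 10) ^+ tin) ^+ 2 * (l * diameter X ^+ 2)
    <= tau / (45 * (l / mu)) ^+ 7 ->
  (1 - (4 * Num.sqrt (9 / 2 * (l / mu)))^-1) ^+ t * (l * diameter Y ^+ 2)
    <= tau / (45 * (l / mu)) ^+ 7 ->
  exists xh N e yh,
  [/\ maximin_ag2 (fun x y => f x y + l * enorm (x - xc) ^+ 2) X Y x0 y0
        (3 * l) (2 * l) mu tau = Some (xh, N),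
      (N <= t.+1 * (4 * tin + 6) + 1)%N, X xh &
      [/\ Y yh, forall y', Y y' -> f xh y' <= f xh yh, dotp e e <= l * tau &
        forall z, X z ->
          0 <= dotp (grad (f^~ yh) xh + (2 * l) *: (xh - xc) - e) (z - xh)]].
Proof.
move=> Xx0 Yy0 tau0 htin ht.
have l0 : 0 < l := lt_le_trans mu0 mul.
have K1 : 10 * (3 * l / (2 * l)) * (3 * l / mu) = 45 * (l / mu).
  by field; rewrite !lt0r_neq0.
have K2 : 3 * l / (2 * l) * (3 * l / mu) = 9 / 2 * (l / mu).
  by field; rewrite !lt0r_neq0.
rewrite -K1 in htin ht; rewrite -K2 in ht.
have [xs [Xxs xs_vi xs_growth xs_lip]] := inner_solution (l := l) xc fs cX mu0 mul.
have [t' [y [yt [x [N [E1 E2 hN [Yy Xx xclose res]]]]]]] :=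
  ag2_stops fs cX cY mu0 mul concave Xxs xs_vi xs_growth xs_lip Xx0 Yy0 tau0 htin ht.
have [e [yh [Yyh yh_max eb evi]]] := ag2_output fs cX cY mu0 mul concave
  Xxs xs_vi tau0 Yy Xx xclose res (erefl _).
have cE : (2 * (3 * l / mu) * (3 * l))^-1 = (18 * (l / mu) * l)^-1.
  by congr (_^-1); field; exact: lt0r_neq0.
exists (proj X (x - (18 * (l / mu) * l)^-1 *: (grad (f^~ y) x + (2 * l) *: (x - xc)))).
exists (N + 1)%N, e, yh; split.
- by rewrite /maximin_ag2 E1 /= E2 /= cE (prox_gradx xc fs).
- by rewrite leq_add2r.
- exact: proj_in.
- by split.
Qed.

End MaximinAG2.


(** * The procedure Minimax-APPA *)

(** The proximal inequality at the new point dominates the gradient-type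
    inequality of the momentum scheme at the extrapolated point: with
    D = z - w = P - Q, |D|^2 <= 3/2 |P|^2 + 3 |Q|^2 trades the strong convexity at
    the new point for a smaller one at w. *)
Lemma prox_to_gradient_model {R : realType} {d : nat} (z w p : 'rV[R]_d)
    (Fz Fp l mu E M : R) : 0 < mu -> mu <= l ->
  Fp + 2 * l * dotp (w - p) (z - p) + E + mu / 2 * dotp (z - p) (z - p) <= Fz ->
  - E <= mu / 8 * dotp (z - p) (z - p) + M ->
  Fp + 2 * l * dotp (w - p) (z - w) + 2 * l / 2 * dotp (w - p) (w - p)
    + mu / 2 / 2 * dotp (z - w) (z - w) - M <= Fz.
Proof.
move=> mu0 mul; have -> : z - w = (z - p) - (w - p).
  by apply/rowP => i; rewrite !mxE; ring.
move: (z - p) (w - p) => P Q h1 h2.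
have h3 := dotp_ge0 (P + 2 *: Q); have h4 := dotp_ge0 Q.
have h5 : 0 <= (l - mu) * dotp Q Q by rewrite mulr_ge0 ?subr_ge0.
have h6 := mulr_ge0 (ltW mu0) h3; have h7 := mulr_ge0 (ltW mu0) h4.
move: h1 h2 h5 h6 h7; dotp_expand; move: (dotp P P) (dotp Q Q) (dotp Q P) (dotp P Q).
move=> a b c c'; clear; lra.
Qed.

Section ProximalScheme.
Context {R : realType} {m n : nat}.
Variables (f : 'rV[R]_m -> 'rV[R]_n -> R) (X : set 'rV[R]_m) (Y : set 'rV[R]_n).
Variables (l mux muy : R).
Hypotheses (fs : jointly_smooth l f) (cX : convex_body X) (cY : convex_body Y).
Hypotheses (mux0 : 0 < mux) (muxl : mux <= l) (muy0 : 0 < muy) (muyl : muy <= l).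
Hypothesis convex : forall y, Y y -> forall x x',
  f x y + dotp (grad (f^~ y) x) (x' - x) + mux / 2 * dotp (x' - x) (x' - x) <= f x' y.
Hypothesis concave : forall x, X x -> forall y y',
  f x y' <= f x y + dotp (grad (f x) y) (y' - y) - muy / 2 * dotp (y' - y) (y' - y).

Let l0 : 0 < l. Proof. exact: (lt_le_trans mux0 muxl). Qed.

Lemma maximizer_growth x y : X x -> Y y -> (forall y', Y y' -> f x y' <= f x y) ->
  forall y', Y y' -> - f x y + muy / 2 * dotp (y' - y) (y' - y) <= - f x y'.
Proof.
move=> Xx Yy ymax.
have ymin y' : Y y' -> - f x y <= - f x y' by move=> Yy'; rewrite lerN2 ymax.
exact: (exact_growth cY muy0 muyl (opp_upper fs x (lexx l)) (opp_lower fs concave Xx)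
  Yy ymin).
Qed.

Variables (ym : 'rV[R]_m -> 'rV[R]_n).
Hypothesis Yym : forall x, Y (ym x).
Hypothesis ym_max : forall x y, Y y -> f x y <= f x (ym x).

Let Phi x := f x (ym x).

Let Phi_lower x z :
  Phi x + dotp (grad (f^~ (ym x)) x) (z - x) + mux / 2 * dotp (z - x) (z - x) <= Phi z.
Proof. exact: le_trans (convex (Yym x) x z) (ym_max z (Yym x)). Qed.

Let Phi_upper x z : X x ->
  Phi z <= Phi x + dotp (grad (f^~ (ym x)) x) (z - x)
    + (l / 2 + l ^+ 2 / (2 * muy)) * dotp (z - x) (z - x).
Proof.
move=> Xx.
pose phi y x : R := - f x y; pose gam y x := - grad (f^~ y) x.
have h1 := maximizer_growth Xx (Yym x) (ym_max x) (Yym z).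
have h2 : phi (ym z) x + dotp (gam (ym z) x) (z - x) - l / 2 * dotp (z - x) (z - x)
          <= phi (ym z) z.
  have := taylor_x fs x z (ym z); rewrite ler_norml => /andP[_ h].
  by rewrite /phi /gam dotpNl -opprD -opprD lerN2 -lerBlDl opprD addrA.
have h3 : enorm (gam (ym z) x - gam (ym x) x) <= l * enorm (ym z - ym x).
  by rewrite /gam opprK addrC (enormB (ym z)); exact: (lip_xy fs).
have := partial_min_lower (phi := phi) (gam := gam) l0 muy0 h1 h2 h3.
by rewrite /phi /gam dotpNl -opprD -opprD lerN2.
Qed.

Lemma primal_minimizer : exists2 xo, X xo &
  forall x, X x -> Phi xo + mux / 2 * dotp (x - xo) (x - xo) <= Phi x.
Proof.
set c := l / 2 + l ^+ 2 / (2 * muy).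
have c0 : 0 <= c.
  by rewrite addr_ge0 ?divr_ge0 ?sqr_ge0 ?mulr_ge0 // ltW.
have [xo Xxo xo_min] : exists2 x, X x & forall x', X x' -> Phi x <= Phi x'.
  apply: (argmin_exists (gr := fun x => grad (f^~ (ym x)) x) (c := c) cX) => x z Xx _.
  have p0 : 0 <= mux / 2 * dotp (z - x) (z - x).
    by rewrite mulr_ge0 ?dotp_ge0 // divr_ge0 // ltW.
  have q0 : 0 <= c * dotp (z - x) (z - x) by rewrite mulr_ge0 ?dotp_ge0.
  exact: abs_model_le p0 q0 (Phi_lower x z) (Phi_upper z Xx).
exists xo => // x Xx; apply: le_trans (Phi_lower xo x).
rewrite lerD2r lerDl.
exact: (minimizer_first_order (h := Phi) cX c0 Xxo (fun z _ => Phi_upper z Xxo) xo_min).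
Qed.

Variables (S : 'rV[R]_m -> 'rV[R]_m) (sig : R) (x0 xo : 'rV[R]_m).
Hypothesis sig0 : 0 <= sig.
Hypothesis XS : forall w, X (S w).
Hypothesis S_prox : forall w, exists e yh, [/\ Y yh,
  forall y, Y y -> f (S w) y <= f (S w) yh, dotp e e <= sig &
  forall z, X z -> 0 <= dotp (grad (f^~ yh) (S w) + (2 * l) *: (S w - w) - e) (z - S w)].
Hypothesis Xx0 : X x0.
Hypothesis Xxo : X xo.
Hypothesis xo_growth : forall x, X x ->
  Phi xo + mux / 2 * dotp (x - xo) (x - xo) <= Phi x.

Let prox_step_lower w z : X z ->
  Phi (S w) + 2 * l * dotp (w - S w) (z - w) + 2 * l / 2 * dotp (w - S w) (w - S w)
    + mux / 2 / 2 * dotp (z - w) (z - w) - 2 * sig / mux <= Phi z.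
Proof.
move=> Xz; have [e [yh [Yyh yh_max eb vi]]] := S_prox w.
have c0 : 0 < mux / 8 by rewrite divr_gt0.
have := dotp_young (z - S w) e c0; rewrite ler_norml => /andP[h _].
have E : dotp e e / (4 * (mux / 8)) = 2 * dotp e e / mux.
  by field; exact: lt0r_neq0.
have {}h : - dotp e (z - S w) <= mux / 8 * dotp (z - S w) (z - S w) + 2 * sig / mux.
  rewrite lerNl dotpC; apply: le_trans h; rewrite lerN2 lerD2l E.
  by rewrite ler_wpM2r ?invr_ge0 ?(ltW mux0) // ler_wpM2l.
apply: (prox_to_gradient_model mux0 muxl _ h).
have PhiE : Phi (S w) <= f (S w) yh by exact: yh_max.
have hv : 0 <= dotp (grad (f^~ yh) (S w)) (z - S w)
                - 2 * l * dotp (w - S w) (z - S w) - dotp e (z - S w).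
  have := vi z Xz; move: (grad _ _) (z - S w) => G D.
  rewrite (dotpDl _ (- e)) (dotpDl G) dotpNl dotpZl.
  by rewrite -(opprB w) dotpNl mulrN.
have h1 := convex Yyh (S w) z; have h2 : f z yh <= Phi z by exact: ym_max.
apply: le_trans (le_trans h1 h2).
by rewrite lerD2r -addrA; apply: lerD => //; lra.
Qed.

(** B bounds the objective error of all iterates after the first t.  By the growth
    of the objective at its minimizer xo, three successive iterates are close to
    xo, hence the last proximal step S p.2 - p.2, which enters the first-order
    condition of the output, is short. *)
Lemma proximal_scheme_rate t k s B p :
  k = l / mux -> s = 2 * Num.sqrt k ->
  B = (1 - s^-1) ^+ t * (2 * l * diameter X ^+ 2) + 4 * k ^+ 2 * (sig / l) ->
  p = momentum S ((s - 1) / (s + 1)) x0 t.+2 ->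
  enorm (S p.2 - p.2) ^+ 2 <= 32 * B / mux.
Proof.
move=> kE sE BE pE'; subst p B s k.
set k := l / mux; set s := 2 * Num.sqrt k; set p := momentum _ _ _ _.
set B := (X in 32 * X).
have k1 : 1 <= k by rewrite ler_pdivlMr // mul1r.
have k0 : 0 < k := lt_le_trans ltr01 k1.
have sq1 : 1 <= Num.sqrt k by rewrite -{1}sqrtr1 ler_wsqrtr.
have s1 : 1 <= s by rewrite /s; lra.
have s0 : 0 < s := lt_le_trans ltr01 s1.
have sk : s <= 2 * k.
  have sq2 : Num.sqrt k * Num.sqrt k = k by rewrite -expr2 sqr_sqrtr // ltW.
  by rewrite /s ler_pM2l // -[leRHS]sq2 ler_peMr ?sqrtr_ge0.
have a0 : 0 < s^-1 by rewrite invr_gt0.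
have a1 : s^-1 <= 1 by rewrite invf_le1.
have aE : s^-1 ^+ 2 * (2 * l) = mux / 2.
  rewrite exprVn /s exprMn sqr_sqrtr ?(ltW k0) // /k; field.
  by rewrite !lt0r_neq0.
have e0 : 0 <= 2 * sig / mux by rewrite divr_ge0 ?mulr_ge0 // ltW.
have diam z z' : X z -> X z' -> dotp (z - z') (z - z') <= diameter X ^+ 2.
  move=> Xz Xz'; rewrite -enorm_le; first exact: diameter_ge.
  by apply: le_trans (diameter_ge cX Xz Xz'); exact: enorm_ge0.
have D0 : 0 <= diameter X ^+ 2 := sqr_ge0 _.
have lower w z : X z -> Phi (S w) + 2 * l * dotp (w - S w) (z - w)
    + 2 * l / 2 * dotp (w - S w) (w - S w)
    + s^-1 ^+ 2 * (2 * l) / 2 * dotp (z - w) (z - w) - 2 * sig / mux <= Phi z.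
  by rewrite aE; exact: prox_step_lower.
have l20 : 0 < 2 * l by rewrite mulr_gt0.
pose x j := (momentum S ((s - 1) / (s + 1)) x0 j).1.
have Xx j : X (x j) by exact: momentum_in.
have eB : 2 * sig / mux / s^-1 <= 4 * k ^+ 2 * (sig / l).
  have -> : 2 * sig / mux / s^-1 = 2 * (sig / mux) * s by field; rewrite !lt0r_neq0.
  have -> : 4 * k ^+ 2 * (sig / l) = 2 * (sig / mux) * (2 * k).
    by rewrite /k; field; rewrite !lt0r_neq0.
  by rewrite ler_wpM2l // mulr_ge0 // divr_ge0 // ltW.
have rate j : (t <= j)%N -> enorm (x j.+1 - xo) ^+ 2 <= 2 * B / mux.
  move=> tj; have := momentum_rate l20 a0 a1 e0 Xx0 Xxo XS diam lower j.
  rewrite -momentum_weightE // -/(x j.+1) => h.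
  have g1 := xo_growth (Xx j.+1).
  have g2 : mux / 2 * dotp (x j.+1 - xo) (x j.+1 - xo) <= B.
    apply: (@le_trans _ _ (Phi (x j.+1) - Phi xo)); first by rewrite lerBrDl.
    apply: le_trans h _; apply: lerD _ eB.
    apply: ler_wpM2r; first by rewrite mulr_ge0 // ltW.
    by apply: ler_wiXn2l => //; [rewrite subr_ge0 | rewrite gerBl ltW].
  rewrite sqr_enorm ler_pdivlMr //; move: g2.
  by move: (dotp _ _) => v; lra.
have B0 : 0 <= 2 * B / mux by apply: le_trans (rate t _); rewrite ?sqr_ge0.
pose r := Num.sqrt (2 * B / mux).
have r0 : 0 <= r := sqrtr_ge0 _.
have {}rate j : (t <= j)%N -> enorm (x j.+1 - xo) <= r.
  move=> tj; rewrite -ler_sqr ?nnegrE ?enorm_ge0 // /r (sqr_sqrtr B0); exact: rate.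
have th0 : 0 <= (s - 1) / (s + 1) by rewrite divr_ge0 ?subr_ge0 // addr_ge0 // ltW.
have th1 : (s - 1) / (s + 1) <= 1.
  by rewrite ler_pdivrMr ?addr_gt0 // mul1r; lra.
have pE : p.2 = x t.+2 + ((s - 1) / (s + 1)) *: (x t.+2 - x t.+1) by [].
have SpE : S p.2 = x t.+3 by [].
have hd : enorm (S p.2 - p.2) <= 4 * r.
  rewrite SpE pE.
  have -> : x t.+3 - (x t.+2 + ((s - 1) / (s + 1)) *: (x t.+2 - x t.+1)) =
    (x t.+3 - xo) + (xo - x t.+2) - ((s - 1) / (s + 1)) *: (x t.+2 - x t.+1).
    by rewrite addrA subrK opprD addrA.
  apply: le_trans (enorm_triangle _ _) _.
  have h1 : enorm ((x t.+3 - xo) + (xo - x t.+2)) <= r + r.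
    apply: le_trans (enorm_triangle _ _) _; rewrite (enormB xo).
    by apply: lerD; apply: rate; rewrite ?leqW.
  have h2 : enorm (x t.+2 - x t.+1) <= r + r.
    have := enorm_triangle (x t.+2 - xo) (xo - x t.+1); rewrite addrA subrK.
    move=> /le_trans; apply; rewrite (enormB xo).
    by apply: lerD; apply: rate; rewrite ?leqW.
  have h3 : enorm (((s - 1) / (s + 1)) *: (x t.+2 - x t.+1)) <= r + r.
    by rewrite enormZ // -[leRHS]mul1r ler_pM ?enorm_ge0.
  rewrite enormN; have -> : 4 * r = (r + r) + (r + r) by ring.
  exact: lerD.
have -> : 32 * B / mux = (4 * r) ^+ 2.
  by rewrite exprMn /r (sqr_sqrtr B0); field; exact: lt0r_neq0.
by rewrite ler_sqr ?nnegrE ?enorm_ge0 ?mulr_ge0.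
Qed.

End ProximalScheme.


(** Bookkeeping for the final gap: the four error terms amount to at most
    0.02, 0.384 + 0.0768, 0.0002 and 0.03 times eps. *)
Lemma gap_budget {R : realType} (l mux muy eps kx ky delta teps B C : R) :
  0 < mux -> 0 < muy -> 0 < eps -> 1 <= kx -> 1 <= ky ->
  l = kx * mux -> l = ky * muy ->
  delta = eps / (10 * kx * ky) ^+ 4 -> teps = eps / (10 ^+ 2 * kx * ky) ->
  B = 2 * C + 4 * kx ^+ 2 * (l * delta / l) ->
  10 ^+ 3 * kx ^+ 2 * C <= eps ->
  2 * kx * ky * teps
    + 3 / (2 * mux) * (4 * l ^+ 2 * (32 * B / mux) + l * delta + 2 * l ^+ 2 * teps / muy)
    <= eps.
Proof.
move=> mux0 muy0 eps0 kx1 ky1 lx ly dE tE BE hC.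
have kx0 : 0 < kx := lt_le_trans ltr01 kx1.
have ky0 : 0 < ky := lt_le_trans ltr01 ky1.
have nx : mux != 0 by rewrite lt0r_neq0.
have ny : muy != 0 by rewrite lt0r_neq0.
have nkx : kx != 0 by rewrite lt0r_neq0.
have nky : ky != 0 by rewrite lt0r_neq0.
have d0 : 0 < delta by rewrite dE divr_gt0 // exprn_gt0 // !mulr_gt0.
pose P := kx ^+ 4 * delta; pose q := ky ^+ 4.
have P0 : 0 < P by rewrite mulr_gt0 // exprn_gt0.
have q1 : 1 <= q by rewrite exprn_ege1.
have epsE : eps = 10 * (10 * (10 * (10 * (P * q)))).
  by rewrite /P /q dE; field; rewrite nkx nky.
have Pq : P <= P * q by rewrite ler_peMr // ltW.
have Q1 : kx * delta <= P.
  rewrite /P ler_wpM2r ?(ltW d0) // exprS ler_peMr ?(ltW kx0) // exprn_ege1 //.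
have T1 : 2 * kx * ky * teps = eps / 50 by rewrite tE; field; rewrite nkx nky.
have ln : l != 0 by rewrite lx mulf_neq0.
have T2 : 3 / (2 * mux) * (4 * l ^+ 2 * (32 * B / mux)) =
   3 * (8 * (8 * (2 * (kx ^+ 2 * C)))) + 3 * (8 * (8 * (4 * P))).
  have ld : l * delta / l = delta by rewrite mulrC mulKf.
  by rewrite BE ld /P lx; field.
have T3 : 3 / (2 * mux) * (l * delta) = 3 / 2 * (kx * delta) by rewrite lx; field.
have T4 : 3 / (2 * mux) * (2 * l ^+ 2 * teps / muy) = 3 / 100 * eps.
  by rewrite expr2 {1}lx {1}ly tE; field; rewrite nkx nky nx ny.
rewrite !mulrDr T1 T2 T3 T4.
have hC' : 10 * (10 * (10 * (kx ^+ 2 * C))) <= eps.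
  by apply: le_trans hC; rewrite le_eqVlt; apply/orP; left; apply/eqP; ring.
move: epsE Pq Q1 hC' P0 eps0.
move: (P * q) (kx * delta) (kx ^+ 2 * C) => a b c; lra.
Qed.

Section MinimaxAPPAProof.
Context {R : realType} {m n : nat}.
Variables (f : 'rV[R]_m -> 'rV[R]_n -> R) (X : set 'rV[R]_m) (Y : set 'rV[R]_n).
Variables (l mux muy : R).
Hypotheses (fs : jointly_smooth l f) (cX : convex_body X) (cY : convex_body Y).
Hypotheses (mux0 : 0 < mux) (muxl : mux <= l) (muy0 : 0 < muy) (muyl : muy <= l).
Hypothesis convex : forall y, Y y -> forall x x',
  f x y + dotp (grad (f^~ y) x) (x' - x) + mux / 2 * dotp (x' - x) (x' - x) <= f x' y.
Hypothesis concave : forall x, X x -> forall y y',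
  f x y' <= f x y + dotp (grad (f x) y) (y' - y) - muy / 2 * dotp (y' - y) (y' - y).

Let l0 : 0 < l. Proof. exact: (lt_le_trans mux0 muxl). Qed.

(** The duality gap of the output.  The maximal side is controlled by the last
    gradient step along y.  On the minimal side, the first-order condition at x
    with its maximizer ys gives the one with yh up to a vector s, which strong
    convexity turns into a loss of |s|^2 / (2 mux). *)
Lemma output_gap x w e ys yt yh delta teps r2 :
  X x -> Y ys -> (forall y, Y y -> f x y <= f x ys) -> dotp e e <= l * delta ->
  (forall z, X z -> 0 <= dotp (grad (f^~ ys) x + (2 * l) *: (x - w) - e) (z - x)) ->
  enorm (x - w) ^+ 2 <= r2 ->
  Y yt -> f x ys <= f x yt + teps ->
  yh = proj Y (yt + (2 * (l / mux) * l)^-1 *: grad (f x) yt) ->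
  saddle_point (2 * (l / mux) * (l / muy) * teps
    + 3 / (2 * mux) * (4 * l ^+ 2 * r2 + l * delta + 2 * l ^+ 2 * teps / muy)) f X Y x yh.
Proof.
move=> Xx Yys ys_max eb vi hr Yyt yt_opt yhE.
have Yyh : Y yh by rewrite yhE; exact: proj_in.
set L := 2 * (l / mux) * l in yhE.
have k1 : 1 <= l / mux by rewrite ler_pdivlMr // mul1r.
have lL : l <= L.
  rewrite /L ler_peMl ?(ltW l0) //; move: (l / mux) k1 => k k1; lra.
have mL : muy <= L := le_trans muyl lL.
have ys_min y' : Y y' -> - f x ys <= - f x y' by move=> Yy'; rewrite lerN2 ys_max.
have up := opp_upper fs x lL; have lo := opp_lower fs concave Xx.
have yhE' : proj Y (yt - L^-1 *: grad (fun v => - f x v) yt) = yh.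
  by rewrite (grad_oppy fs) scalerN opprK.
have close : dotp (yt - ys) (yt - ys) <= 2 * teps / muy.
  have := exact_growth cY muy0 mL up lo Yys ys_min Yyt.
  rewrite ler_pdivlMr //; move: yt_opt.
  by move: (f x ys) (f x yt) (dotp _ _) => a b c; lra.
have gain : f x ys <= f x yh + 2 * (l / mux) * (l / muy) * teps.
  have := exact_step_gain cY muy0 mL up lo yt Yys; rewrite yhE' => h.
  have h0 : 0 <= L / 2 * dotp (yh - ys) (yh - ys).
    by rewrite mulr_ge0 ?dotp_ge0 // divr_ge0 // (le_trans (ltW l0)).
  have h1 : (L - muy) / 2 * dotp (yt - ys) (yt - ys) <= L / 2 * (2 * teps / muy).
    apply: ler_pM close; rewrite ?dotp_ge0 ?divr_ge0 ?subr_ge0 //.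
    by rewrite ler_wpM2r // gerBl ltW.
  have E : L / 2 * (2 * teps / muy) = 2 * (l / mux) * (l / muy) * teps.
    by rewrite /L; field; rewrite !lt0r_neq0.
  rewrite E in h1; move: h h0 h1; move: (f x ys) (f x yh) => a b.
  by move: (_ * dotp (yt - ys) _) (_ * dotp (yh - ys) _) (_ * teps) => u v z; lra.
have close2 : dotp (yh - ys) (yh - ys) <= 2 * teps / muy.
  apply: le_trans close; rewrite -ler_enorm -yhE'.
  exact: (exact_step_nonexpansive cY muy0 mL up lo Yys ys_min).
pose s := (2 * l) *: (w - x) + e + (grad (f^~ yh) x - grad (f^~ ys) x).
have sb : dotp s s <= 3 * (4 * l ^+ 2 * r2 + l * delta + 2 * l ^+ 2 * teps / muy).
  apply: le_trans (dotpD_le3 _ _ _) _; rewrite ler_pM2l //.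
  apply: lerD; first apply: lerD => //.
    rewrite -sqr_enorm enormZ ?mulr_ge0 ?(ltW l0) // exprMn (enormB w).
    have -> : (2 * l) ^+ 2 = 4 * l ^+ 2 by ring.
    by rewrite ler_wpM2l // mulr_ge0 ?sqr_ge0.
  have h := lip_xy fs x yh ys.
  apply: (@le_trans _ _ ((l * enorm (yh - ys)) ^+ 2)).
    by rewrite -enorm_le // mulr_ge0 ?enorm_ge0 ?(ltW l0).
  rewrite exprMn sqr_enorm.
  have -> : 2 * l ^+ 2 * teps / muy = l ^+ 2 * (2 * teps / muy) by ring.
  by rewrite ler_wpM2l ?sqr_ge0.
have low z : X z -> f x yh <= f z yh +
    3 / (2 * mux) * (4 * l ^+ 2 * r2 + l * delta + 2 * l ^+ 2 * teps / muy).
  move=> Xz; have h1 := convex Yyh x z.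
  have h2 : 0 <= dotp (grad (f^~ yh) x) (z - x) - dotp s (z - x).
    have := vi z Xz; congr (_ <= _).
    rewrite -dotpNl -dotpDl; congr (dotp _ _).
    rewrite /s; move: (grad _ x) (grad _ x) => p q.
    by apply/rowP => i; rewrite !mxE; ring.
  have c0 : 0 < mux / 2 by rewrite divr_gt0.
  have := dotp_young (z - x) s c0; rewrite ler_norml dotpC => /andP[h3 _].
  have h4 : dotp s s / (4 * (mux / 2)) <=
    3 / (2 * mux) * (4 * l ^+ 2 * r2 + l * delta + 2 * l ^+ 2 * teps / muy).
    have -> : 4 * (mux / 2) = 2 * mux by field.
    rewrite [leRHS]mulrAC; apply: ler_wpM2r sb.
    by rewrite invr_ge0 mulr_ge0 // ltW.
  move: h1 h2 h3 h4; move: (_ * (_ + _ + _)) => M.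
  move: (f x yh) (f z yh) (dotp s (z - x)) (dotp s s / _) (dotp (grad _ _) _).
  by move=> a b c d g; lra.
have [[x1 Xx1] _ _ _] := cX; have [[y1 Yy1] _ _ _] := cY.
split => //; rewrite lerBlDr.
set A := 2 * (l / mux) * (l / muy) * teps; set B := 3 / _ * _.
apply: (@le_trans _ _ (f x yh + A)).
  apply: ge_sup; first by exists (f x y1), y1.
  by move=> _ [y Yy <-]; apply: le_trans (ys_max y Yy) gain.
have : f x yh - B <= inf [set f z yh | z in X].
  apply: lb_le_inf; first by exists (f x1 yh), x1.
  by move=> _ [z Xz <-]; rewrite lerBlDr; exact: low.
by move: (inf _) => I; lra.
Qed.

(** The loops are run for t + 3 proximal steps, at most t1 + 1 steps of Maximin-AG2
    in each of them, at most tin + 1 steps of AGD in each inner call, and at most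
    t2 + 1 steps in the final call of AGD.  The distance between successive
    iterates is under control from the third proximal step on. *)
Lemma minimax_appa_saddle x0 y0 eps t t1 tin t2 :
  X x0 -> Y y0 -> 0 < eps ->
  let kx := l / mux in
  let ky := l / muy in
  let tt := eps / (10 * kx * ky) ^+ 4 / (45 * ky) ^+ 7 in
  10 ^+ 3 * kx ^+ 2 * ((1 - (2 * Num.sqrt kx)^-1) ^+ t * (l * diameter X ^+ 2)) <= eps ->
  (1 - (4 * Num.sqrt (9 / 2 * ky))^-1) ^+ t1 * (l * diameter Y ^+ 2) <= tt ->
  25 / 2 * ((9 / 10) ^+ tin) ^+ 2 * (l * diameter X ^+ 2) <= tt ->
  16 * ky ^+ 3 * ((1 - (Num.sqrt ky)^-1) ^+ t2 * (l * diameter Y ^+ 2))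
    <= eps / (10 ^+ 2 * kx * ky) ->
  exists xh yh N,
  [/\ minimax_appa f X Y x0 y0 l mux muy eps t.+3 = Some (xh, yh, N),
      saddle_point eps f X Y xh yh &
      (N <= t.+3 * (t1.+1 * (4 * tin + 6) + 1) + 2 * t2.+1 + 1)%N].
Proof.
move=> Xx0 Yy0 eps0 kx ky tt ht ht1 htin ht2.
have kx1 : 1 <= kx by rewrite ler_pdivlMr // mul1r.
have ky1 : 1 <= ky by rewrite ler_pdivlMr // mul1r.
have kx0 : 0 < kx := lt_le_trans ltr01 kx1.
have ky0 : 0 < ky := lt_le_trans ltr01 ky1.
set delta := eps / (10 * kx * ky) ^+ 4 in tt ht1 htin.
have kxy0 : 0 < 10 * kx * ky by apply: mulr_gt0 => //; apply: mulr_gt0.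
have delta0 : 0 < delta by rewrite divr_gt0 // exprn_gt0.
set Bd := (t1.+1 * (4 * tin + 6) + 1)%N.
have /choice[p pP] : forall xc, exists p : 'rV[R]_m * nat,
  [/\ maximin_ag2 (fun x y => f x y + l * enorm (x - xc) ^+ 2) X Y x0 y0
        (3 * l) (2 * l) muy delta = Some p,
      (p.2 <= Bd)%N, X p.1 &
      exists e yh, [/\ Y yh, forall y', Y y' -> f p.1 y' <= f p.1 yh,
        dotp e e <= l * delta &
        forall z, X z ->
          0 <= dotp (grad (f^~ yh) p.1 + (2 * l) *: (p.1 - xc) - e) (z - p.1)]].
  move=> xc; have [xh [N [e [yh [E hN Xxh H]]]]] :=
    maximin_ag2_converges fs cX cY muy0 muyl concave xc Xx0 Yy0 delta0 htin ht1.
  by exists (xh, N); split => //; exists e, yh.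
pose S xc := (p xc).1.
pose s := 2 * Num.sqrt kx.
pose it := momentum S ((s - 1) / (s + 1)) x0.
have iterE j : exists2 N, iter j (obind (appa_step f X Y x0 y0 l mux muy eps))
    (Some (x0, x0, 0%N)) = Some ((it j).1, (it j).2, N) & (N <= j * Bd)%N.
  elim: j => [|j [N E hN]]; first by exists 0%N.
  exists (N + (p (it j).2).2)%N; last first.
    have [_ h _ _] := pP (it j).2.
    by rewrite mulSn addnC leq_add.
  rewrite iterS E /=; have [-> _ _ _] := pP (it j).2.
  by rewrite /= /S; case: (p (it j).2).
have [N E hN] := iterE t.+3.
set w := (it t.+2).2; set xT := S w.
have [_ _ XxT [e [ys [Yys ys_max eb vi]]]] := pP w.
rewrite -/(S w) -/xT in XxT ys_max vi.
have /choice[ym ymP] : forall x, exists y, Y y /\ forall y', Y y' -> f x y' <= f x y.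
  by move=> x; have [y Yy ymax] := maximizer_exists fs cY x; exists y.
have Yym x : Y (ym x) by have [] := ymP x.
have ym_max x y : Y y -> f x y <= f x (ym x) by have [_] := ymP x; apply.
have XS v : X (S v) by have [] := pP v.
have S_prox v : exists e yh, [/\ Y yh,
    forall y, Y y -> f (S v) y <= f (S v) yh, dotp e e <= l * delta &
    forall z, X z ->
      0 <= dotp (grad (f^~ yh) (S v) + (2 * l) *: (S v - v) - e) (z - S v)].
  by have [] := pP v.
have [xo Xxo xo_growth] :=
  primal_minimizer fs cX cY mux0 muxl muy0 muyl convex concave Yym ym_max.
have ld0 : 0 <= l * delta by rewrite mulr_ge0 // ltW.
have rate := proximal_scheme_rate cX mux0 muxl convex Yym ym_max ld0 XS S_prox Xx0 Xxo
  xo_growth (erefl kx) (erefl s) (erefl _) (erefl (it t.+2)).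
have muy_m : muy <= l := muyl.
set teps := eps / (10 ^+ 2 * kx * ky) in ht2.
have up := opp_upper fs xT (lexx l); have lo := opp_lower fs concave XxT.
have diam z z' : Y z -> Y z' -> dotp (z - z') (z - z') <= diameter Y ^+ 2.
  move=> Yz Yz'; rewrite -enorm_le; first exact: diameter_ge.
  by apply: le_trans (diameter_ge cY Yz Yz'); exact: enorm_ge0.
have [yt [t' [A ht' Yyt yt_opt]]] :=
  agd_converges cY Yy0 muy0 muyl up lo diam ht2.
have yt_opt' : f xT ys <= f xT yt + teps.
  by have := yt_opt ys Yys; rewrite lerNl opprD opprK lerBlDr.
have gap := output_gap XxT Yys ys_max eb vi rate Yyt yt_opt' (erefl _).
exists xT, (proj Y (yt + (2 * kx * l)^-1 *: grad (f xT) yt)), (N + 2 * t' + 1)%N.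
split.
- by rewrite /minimax_appa E /= -/kx -/ky -/teps A.
- have [Xx Yy G] := gap; split => //; apply: le_trans G _.
  have lx : l = kx * mux by rewrite divfK // lt0r_neq0.
  have ly : l = ky * muy by rewrite divfK // lt0r_neq0.
  apply: (gap_budget mux0 muy0 eps0 kx1 ky1 lx ly (erefl _) (erefl _) _ ht).
  by congr (_ + _); ring.
- by move: hN ht'; rewrite -/Bd; clear; lia.
Qed.

End MinimaxAPPAProof.

(** * Iteration counts *)

Section IterationCounts.
Context {R : realType}.
Implicit Types (a P Q q Z eps x y : R).

Lemma decay_steps a (Lam : R) (K : nat) : 0 < a -> a <= 1 -> 1 <= Lam ->
  exists2 t : nat, (1 - a) ^+ t * Lam ^+ K <= 1 & t%:R <= K%:R * ln Lam / a + 1.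
Proof.
move=> a0 a1 Lam1; have Lam0 : 0 < Lam := lt_le_trans ltr01 Lam1.
set z := K%:R * ln Lam / a.
have z0 : 0 <= z by rewrite divr_ge0 ?mulr_ge0 ?ln_ge0 // ltW.
have /andP[tz zt] := truncn_itv z0.
exists (Num.truncn z).+1; last by rewrite -natr1 lerD2r.
set t := (Num.truncn z).+1 in zt *.
have h1 : (1 - a) ^+ t <= expR (- (a * t%:R)).
  rewrite -mulNr mulrC expRM_natl; apply: lerXn2r.
  - by rewrite nnegrE subr_ge0.
  - by rewrite nnegrE expR_ge0.
  - exact: expR_ge1Dx.
have h2 : Lam ^+ K = expR (K%:R * ln Lam) by rewrite expRM_natl lnK.
apply: (@le_trans _ _ (expR (- (a * t%:R)) * expR (K%:R * ln Lam))).
  by rewrite -h2 ler_wpM2r // exprn_ge0 // ltW.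
rewrite -expRD -[leRHS]expR0 ler_expR addrC subr_le0.
by move: zt; rewrite /z ltr_pdivrMr // (mulrC a) => /ltW.
Qed.

Lemma tolerance_met P Q q Z eps (Lam : R) :
  0 <= P -> 0 < Q -> 0 <= q -> 0 <= Z -> 0 <= eps -> P * Q <= Lam ^+ 79 ->
  Z <= Lam * eps -> q * Lam ^+ 80 <= 1 -> P * (q * Z) <= eps / Q.
Proof.
move=> P0 Q0 q0 Z0 eps0 PQ hZ hq; rewrite ler_pdivlMr //.
have -> : P * (q * Z) * Q = q * (P * Q * Z) by ring.
apply: (@le_trans _ _ (q * (Lam ^+ 79 * (Lam * eps)))).
  by rewrite ler_wpM2l // ler_pM // mulr_ge0 // ltW.
have -> : q * (Lam ^+ 79 * (Lam * eps)) = q * Lam ^+ 80 * eps.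
  by rewrite (exprSr _ 79) !mulrA.
by rewrite ler_piMl.
Qed.

Lemma pow_boundM x y (Lam : R) i j :
  0 <= x <= Lam ^+ i -> 0 <= y <= Lam ^+ j -> 0 <= x * y <= Lam ^+ (i + j).
Proof.
move=> /andP[x0 xi] /andP[y0 yj].
by rewrite mulr_ge0 //= exprD ler_pM.
Qed.

Lemma pow_boundX x (Lam : R) i j :
  0 <= x <= Lam ^+ i -> 0 <= x ^+ j <= Lam ^+ (i * j).
Proof.
move=> /andP[x0 xi]; rewrite exprn_ge0 //= exprM lerXn2r // nnegrE //.
exact: le_trans xi.
Qed.

Lemma pow_bound_nat (k j : nat) (Lam : R) : 2 <= Lam -> (k <= 2 ^ j)%N ->
  0 <= (k%:R : R) <= Lam ^+ j.
Proof.
move=> Lam2 kj; rewrite ler0n /=; apply: (@le_trans _ _ ((2 ^ j)%N%:R)).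
  by rewrite ler_nat.
by rewrite natrX lerXn2r ?nnegrE // (le_trans _ Lam2).
Qed.

(** The tolerances are eps over polynomials in the condition numbers, which are
    bounded by Lam; since Lam >= 2, numerical factors are powers of Lam as well
    (10 <= Lam^4, 45 <= Lam^6).  The factor l D^2 / eps takes one more power. *)
Lemma tolerances_le_power kx ky (Lam : R) :
  2 <= Lam -> 0 <= kx <= Lam ^+ 1 -> 0 <= ky <= Lam ^+ 1 ->
  [/\ 10 ^+ 3 * kx ^+ 2 <= Lam ^+ 79,
      (10 * kx * ky) ^+ 4 * (45 * ky) ^+ 7 <= Lam ^+ 79,
      25 / 2 * ((10 * kx * ky) ^+ 4 * (45 * ky) ^+ 7) <= Lam ^+ 79 &
      16 * ky ^+ 3 * (10 ^+ 2 * kx * ky) <= Lam ^+ 79].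
Proof.
move=> Lam2 hx hy; have Lam1 : 1 <= Lam by rewrite (le_trans _ Lam2) // ler1n.
have up x i : 0 <= x <= Lam ^+ i -> (i <= 79)%N -> x <= Lam ^+ 79.
  by move=> /andP[_ xi] i79; apply: le_trans xi _; exact: ler_weXn2l.
have n10 := @pow_bound_nat 10 4 Lam Lam2 isT.
have n45 := @pow_bound_nat 45 6 Lam Lam2 isT.
have n16 := @pow_bound_nat 16 4 Lam Lam2 isT.
have n25 : 0 <= (25 / 2 : R) <= Lam ^+ 4.
  have /andP[_ h] := n16; apply/andP; split; first exact: divr_ge0.
  by apply: le_trans h; rewrite ler_pdivrMr // -natrM ler_nat.
have hb := pow_boundM (pow_boundX 4 (pow_boundM (pow_boundM n10 hx) hy))
  (pow_boundX 7 (pow_boundM n45 hy)).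
split.
- exact: up (pow_boundM (pow_boundX 3 n10) (pow_boundX 2 hx)) isT.
- exact: up hb isT.
- exact: up (pow_boundM n25 hb) isT.
- exact: up (pow_boundM (pow_boundM n16 (pow_boundX 3 hy))
    (pow_boundM (pow_boundM (pow_boundX 2 n10) hx) hy)) isT.
Qed.

(** Each of the three nested loops contributes a logarithm, and the two outer ones
    a square root of a condition number; lam >= 1/2 lets the lower order terms be
    charged to the product. *)
Lemma total_count (c X Y lam : R) (T T1 Q T2 N : nat) :
  20 <= c -> 1 <= X -> 1 <= Y -> 1 <= 2 * lam ->
  T%:R <= c * X * lam -> T1%:R <= c * Y * lam -> Q%:R <= c ^+ 2 * lam ->
  T2%:R <= c * Y * lam -> (N <= T * (T1 * Q + 1) + 2 * T2 + 1)%N ->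
  N%:R <= c ^+ 5 * (X * Y) * lam ^+ 3.
Proof.
move=> c20 X1 Y1 lam1 hT hT1 hQ hT2 hN.
have c0 : 0 < c by lra.
have c10 : 10 <= c by lra.
have c1 : 1 <= c by lra.
have lam0 : 0 < lam by lra.
have X0 : 0 < X by lra.
have Y0 : 0 < Y by lra.
have lam2 : 1 <= 4 * lam ^+ 2.
  by have := exprn_ege1 2 lam1; rewrite exprMn -natrX.
have hP : (T1 * Q)%:R <= c ^+ 3 * Y * lam ^+ 2.
  rewrite natrM; apply: le_trans (ler_pM _ _ hT1 hQ) _ => //.
  by rewrite le_eqVlt; apply/orP; left; apply/eqP; ring.
have h1 : (T1 * Q + 1)%:R <= 2 * (c ^+ 3 * Y * lam ^+ 2).
  rewrite natrD mulr_natl mulr2n; apply: lerD hP _.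
  apply: (le_trans lam2); rewrite ler_pM2r ?exprn_gt0 //.
  have : 10 ^+ 3 <= c ^+ 3 by rewrite lerXn2r // nnegrE ltW.
  have : 4 <= 10 ^+ 3 :> R by rewrite -natrX ler_nat.
  move=> a b; apply: le_trans a _; apply: le_trans b _.
  by rewrite ler_peMr // exprn_ge0 // ltW.
have h2 : (T * (T1 * Q + 1))%:R <= 2 * (c ^+ 4 * (X * Y) * lam ^+ 3).
  rewrite natrM; apply: le_trans (ler_pM _ _ hT h1) _ => //.
  by rewrite le_eqVlt; apply/orP; left; apply/eqP; ring.
have XY : 1 <= X * Y by rewrite mulr_ege1.
have p1 : Y * lam <= 4 * (X * Y * lam ^+ 3).
  have -> : 4 * (X * Y * lam ^+ 3) = Y * lam * (X * (4 * lam ^+ 2)) by ring.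
  by rewrite ler_peMr ?mulr_ge0 ?(ltW Y0) ?(ltW lam0) // mulr_ege1.
have p2 : 1 <= 8 * (X * Y * lam ^+ 3).
  have -> : 8 * (X * Y * lam ^+ 3) = X * Y * ((2 * lam) * (4 * lam ^+ 2)) by ring.
  by rewrite mulr_ege1 // mulr_ege1.
have V0 : 0 <= X * Y * lam ^+ 3.
  by rewrite !mulr_ge0 ?exprn_ge0 // ltW.
have hN' : N%:R <= (T * (T1 * Q + 1))%:R + 2 * T2%:R + 1 :> R.
  by rewrite -natrM -natrD -[1 in leRHS]/(1%:R) -natrD ler_nat.
apply: le_trans hN' _.
have q1 : c * (Y * lam) <= c * (4 * (X * Y * lam ^+ 3)) by rewrite ler_pM2l.
have hT2' : T2%:R <= c * (4 * (X * Y * lam ^+ 3)).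
  by apply: le_trans hT2 _; rewrite -mulrA.
have -> : c ^+ 5 * (X * Y) * lam ^+ 3 = c * (c ^+ 4 * (X * Y * lam ^+ 3)) by ring.
have E2 : c ^+ 4 * (X * Y) * lam ^+ 3 = c ^+ 4 * (X * Y * lam ^+ 3) by ring.
rewrite E2 in h2.
move: h2 hT2' p2 V0; move: (X * Y * lam ^+ 3) => V h2 hT2' p2 V0.
have c3 : c <= c ^+ 4.
  by rewrite exprS ler_peMr ?(ltW c0) // exprn_ege1.
have c4 : 1 <= c ^+ 4 by rewrite exprn_ege1.
have r1 := ler_wpM2r V0 c3; have r2 := ler_wpM2r V0 c4.
have r3 : 0 <= c ^+ 4 * V by rewrite mulr_ge0 // exprn_ge0 // ltW.
have r4 := ler_wpM2r r3 c20.
rewrite mulrCA in hT2'; rewrite mul1r in r2.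
move: h2 hT2' p2 r1 r2 r4; move: (c * (c ^+ 4 * V)) (c ^+ 4 * V) (c * V).
move=> w u v; lra.
Qed.

End IterationCounts.


Lemma half_le_ln {R : realType} (x : R) : 2 <= x -> 1 <= 2 * ln x.
Proof.
move=> x2; have x0 : 0 < x := lt_le_trans (ltr0n _ 2) x2.
have := expR_ge1Dx (- ln x); rewrite expRN lnK // => h.
have : x^-1 <= 2^-1 by rewrite lef_pV2 ?posrE.
by move: h; lra.
Qed.

Lemma loop_counts {R : realType} (X Y S1 lam : R) (t t1 tin t2 : nat) :
  1 <= X -> 1 <= Y -> S1 <= 9 * Y -> 1 <= 2 * lam ->
  t%:R <= 80 * lam * (2 * X) + 1 -> t1%:R <= 80 * lam * S1 + 1 ->
  tin%:R <= 80 * lam * 10 + 1 -> t2%:R <= 80 * lam * Y + 1 ->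
  [/\ t.+3%:R <= 10 ^+ 3 * X * lam, t1.+1%:R <= 10 ^+ 3 * Y * lam,
      (4 * tin + 6)%:R <= (10 ^+ 3) ^+ 2 * lam & t2.+1%:R <= 10 ^+ 3 * Y * lam].
Proof.
move=> X1 Y1 hS lam1 ht ht1 htin ht2.
have lam0 : 0 <= lam by lra.
have xl := ler_wpM2r lam0 X1; have yl := ler_wpM2r lam0 Y1.
have sl := ler_wpM2r lam0 hS.
have -> : 10 ^+ 3 = 10 * (10 * 10) :> R by rewrite !exprS expr0 mulr1.
split.
- by rewrite -[t.+3]addn3 natrD; lra.
- by rewrite -natr1; lra.
- by rewrite natrD natrM expr2; lra.
- by rewrite -natr1; lra.
Qed.

(** A loop with rate a is run for about 80 ln Lam / a iterations, which makes
    (1 - a)^t at most Lam^-80 and meets all the tolerances at once. *)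
Lemma minimax_appa_complexity (R : realType) (m n : nat)
    (f : 'rV[R]_m -> 'rV[R]_n -> R) (X : set 'rV[R]_m) (Y : set 'rV[R]_n)
    (l mux muy eps kx ky Lam : R) (x0 : 'rV[R]_m) (y0 : 'rV[R]_n) :
  jointly_smooth l f -> convex_body X -> convex_body Y ->
  0 < mux -> mux <= l -> 0 < muy -> muy <= l ->
  (forall y, Y y -> forall x x',
    f x y + dotp (grad (f^~ y) x) (x' - x) + mux / 2 * dotp (x' - x) (x' - x)
      <= f x' y) ->
  (forall x, X x -> forall y y',
    f x y' <= f x y + dotp (grad (f x) y) (y' - y) - muy / 2 * dotp (y' - y) (y' - y)) ->
  X x0 -> Y y0 -> 0 < eps -> kx = l / mux -> ky = l / muy ->
  Lam = (kx + ky) * Num.max 1 (l * (diameter X ^+ 2 + diameter Y ^+ 2) / eps) ->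
  exists (T : nat) (xh : 'rV[R]_m) (yh : 'rV[R]_n) (N : nat),
  [/\ (0 < T)%N,
      minimax_appa f X Y x0 y0 l mux muy eps T = Some (xh, yh, N),
      saddle_point eps f X Y xh yh &
      N%:R <= (10 ^+ 3) ^+ 5 * Num.sqrt (kx * ky) * ln Lam ^+ 3].
Proof.
move=> fs cX cY mux0 muxl muy0 muyl convex concave Xx0 Yy0 eps0 kxE kyE LamE.
have l0 : 0 < l := lt_le_trans mux0 muxl.
have kx1 : 1 <= kx by rewrite kxE ler_pdivlMr // mul1r.
have ky1 : 1 <= ky by rewrite kyE ler_pdivlMr // mul1r.
have kx0 : 0 < kx := lt_le_trans ltr01 kx1.
have ky0 : 0 < ky := lt_le_trans ltr01 ky1.
set M := Num.max 1 _ in LamE.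
have M1 : 1 <= M by rewrite le_max lexx.
have kk2 : 2 <= kx + ky by lra.
have Lam2 : 2 <= Lam by rewrite LamE -[leLHS]mulr1 ler_pM.
have Lam1 : 1 <= Lam by lra.
have leLam k : 0 <= k -> k <= kx + ky -> 0 <= k <= Lam ^+ 1.
  move=> k0 kk; rewrite k0 expr1 LamE; apply: le_trans kk _.
  by rewrite ler_peMr // addr_ge0 // ltW.
have hx : 0 <= kx <= Lam ^+ 1 by apply: leLam; lra.
have hy : 0 <= ky <= Lam ^+ 1 by apply: leLam; lra.
have [b1 b2 b3 b4] := tolerances_le_power Lam2 hx hy.
have diam_le D2 : D2 <= diameter X ^+ 2 + diameter Y ^+ 2 -> l * D2 <= Lam * eps.
  move=> hD; rewrite -ler_pdivrMr //; apply: (@le_trans _ _ M).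
    by rewrite le_max; apply/orP; right; rewrite ler_pM2r ?invr_gt0 // ler_pM2l.
  by rewrite LamE ler_peMl //; lra.
have hDx : l * diameter X ^+ 2 <= Lam * eps by rewrite diam_le // lerDl sqr_ge0.
have hDy : l * diameter Y ^+ 2 <= Lam * eps by rewrite diam_le // lerDr sqr_ge0.
have Dx0 : 0 <= l * diameter X ^+ 2 by rewrite mulr_ge0 ?sqr_ge0 // ltW.
have Dy0 : 0 <= l * diameter Y ^+ 2 by rewrite mulr_ge0 ?sqr_ge0 // ltW.
have sx1 : 1 <= Num.sqrt kx by rewrite -{1}sqrtr1 ler_wsqrtr.
have sy1 : 1 <= Num.sqrt ky by rewrite -{1}sqrtr1 ler_wsqrtr.
have inv1 (s : R) : 1 <= s -> 0 < s^-1 /\ s^-1 <= 1.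
  by move=> s1; rewrite invr_gt0 invf_le1 ?(lt_le_trans ltr01 s1).
set S1 := 4 * Num.sqrt (9 / 2 * ky).
have [S1a S1b] : 1 <= S1 /\ S1 <= 9 * Num.sqrt ky.
  have h1 : 1 <= Num.sqrt (9 / 2 * ky) by rewrite -{1}sqrtr1 ler_wsqrtr //; lra.
  have h2 : Num.sqrt (9 / 2 * ky) <= 9 / 4 * Num.sqrt ky.
    have p : 0 <= 9 / 4 * Num.sqrt ky by rewrite mulr_ge0 ?divr_ge0 ?sqrtr_ge0.
    rewrite -(ger0_norm p) -sqrtr_sqr ler_wsqrtr // exprMn sqr_sqrtr ?(ltW ky0) //.
    by rewrite expr2; lra.
  by rewrite /S1; split; lra.
have [a0 a1] := inv1 (2 * Num.sqrt kx) ltac:(lra).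
have [c0 c1] := inv1 S1 S1a.
have [d0 d1] := inv1 (Num.sqrt ky) sy1.
have e0 : 0 < 10^-1 :> R by rewrite invr_gt0.
have e1 : 10^-1 <= 1 :> R by rewrite invf_le1 // ler1n.
have [t ht tb] := decay_steps 80 a0 a1 Lam1.
have [t1 ht1 t1b] := decay_steps 80 c0 c1 Lam1.
have [tin htin tinb] := decay_steps 80 e0 e1 Lam1.
have [t2 ht2 t2b] := decay_steps 80 d0 d1 Lam1.
have e9 : 1 - 10^-1 = 9 / 10 :> R by field.
rewrite e9 in htin.
have pow0 (a : R) j : a <= 1 -> 0 <= (1 - a) ^+ j.
  by move=> ?; rewrite exprn_ge0 // subr_ge0.
have eps0' : 0 <= eps by exact: ltW.
have Q2 : 0 < (10 * kx * ky) ^+ 4 * (45 * ky) ^+ 7.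
  by rewrite mulr_gt0 ?exprn_gt0 // !mulr_gt0.
have Q4 : 0 < 10 ^+ 2 * kx * ky by rewrite !mulr_gt0 // exprn_gt0.
have n9 : 0 <= 9 / 10 :> R by rewrite divr_ge0.
have C1 : 10 ^+ 3 * kx ^+ 2 *
    ((1 - (2 * Num.sqrt kx)^-1) ^+ t * (l * diameter X ^+ 2)) <= eps.
  have q0 := pow0 _ t a1; rewrite -[X in X <= _]mulr1 in b1.
  have P0 : 0 <= 10 ^+ 3 * kx ^+ 2 by rewrite mulr_ge0 ?sqr_ge0.
  rewrite -[leRHS]divr1.
  exact: (tolerance_met P0 ltr01 q0 Dx0 eps0' b1 hDx ht).
have C2 : (1 - S1^-1) ^+ t1 * (l * diameter Y ^+ 2)
    <= eps / (10 * kx * ky) ^+ 4 / (45 * ky) ^+ 7.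
  rewrite -[leLHS]mul1r -[leRHS]mulrA -invfM.
  have q0 := pow0 _ t1 c1; rewrite -[X in X <= _]mul1r in b2.
  exact: (tolerance_met ler01 Q2 q0 Dy0 eps0' b2 hDy ht1).
have C3 : 25 / 2 * ((9 / 10) ^+ tin) ^+ 2 * (l * diameter X ^+ 2)
    <= eps / (10 * kx * ky) ^+ 4 / (45 * ky) ^+ 7.
  apply: (@le_trans _ _ (25 / 2 * ((9 / 10) ^+ tin * (l * diameter X ^+ 2)))).
    rewrite -mulrA ler_wpM2l ?divr_ge0 // ler_wpM2r // expr2 ler_piMl ?exprn_ge0 //.
    by rewrite exprn_ile1 // ler_pdivrMr // mul1r ler_nat.
  rewrite -[leRHS]mulrA -invfM.
  have q0 : 0 <= (9 / 10 : R) ^+ tin by exact: exprn_ge0.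
  have P0 : 0 <= 25 / 2 :> R by exact: divr_ge0.
  exact: (tolerance_met P0 Q2 q0 Dx0 eps0' b3 hDx htin).
have C4 : 16 * ky ^+ 3 * ((1 - (Num.sqrt ky)^-1) ^+ t2 * (l * diameter Y ^+ 2))
    <= eps / (10 ^+ 2 * kx * ky).
  have q0 := pow0 _ t2 d1.
  have P0 : 0 <= 16 * ky ^+ 3 by rewrite mulr_ge0 // exprn_ge0 // ltW.
  exact: (tolerance_met P0 Q4 q0 Dy0 eps0' b4 hDy ht2).
have lam1 := half_le_ln Lam2.
rewrite /S1 kxE kyE in C1 C2 C3 C4.
have [xh [yh [N [E gap hN]]]] := minimax_appa_saddle fs cX cY mux0 muxl muy0 muyl
  convex concave Xx0 Yy0 eps0 C1 C2 C3 C4.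
exists t.+3, xh, yh, N; split => //.
rewrite sqrtrM ?(ltW kx0) //.
rewrite invrK in tb; rewrite invrK in t1b; rewrite invrK in tinb; rewrite invrK in t2b.
have [h1 h2 h3 h4] := loop_counts sx1 sy1 S1b lam1 tb t1b tinb t2b.
by apply: total_count h1 h2 h3 h4 hN => //; rewrite -natrX ler_nat.
Qed.

(* The factor l (Dx^2 + Dy^2) / eps in the logarithm is replaced by 1 when it is
   smaller than 1; for eps <= l (Dx^2 + Dy^2) nothing is changed.  For larger
   eps (for instance when X and Y are singletons) the logarithm would be
   negative, zero or of the form ln 0. *)
Theorem theorem5p1 (R : realType) :
  exists2 C : R, 0 < C &
  forall (m n : nat) (f : 'rV[R]_m -> 'rV[R]_n -> R)
         (X : set 'rV[R]_m) (Y : set 'rV[R]_n) (l mux muy eps : R)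
         (x0 : 'rV[R]_m) (y0 : 'rV[R]_n),
  (0 < m)%N -> (0 < n)%N ->
  jointly_smooth l f ->
  X !=set0 -> closed X -> convex_set X -> bounded_set X ->
  Y !=set0 -> closed Y -> convex_set Y -> bounded_set Y ->
  0 < mux -> 0 < muy ->
  (forall y, Y y -> strongly_convex mux (f^~ y)) ->
  (forall x, X x -> strongly_concave muy (f x)) ->
  X x0 -> Y y0 -> 0 < eps ->
  let kx := l / mux in
  let ky := l / muy in
  let Dx := diameter X in
  let Dy := diameter Y in
  exists (T : nat) (xh : 'rV[R]_m) (yh : 'rV[R]_n) (N : nat),
  [/\ (0 < T)%N,
      minimax_appa f X Y x0 y0 l mux muy eps T = Some (xh, yh, N),
      saddle_point eps f X Y xh yh &
      N%:R <= C * Num.sqrt (kx * ky)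
              * ln ((kx + ky) * Num.max 1 (l * (Dx ^+ 2 + Dy ^+ 2) / eps)) ^+ 3].

Proof.
exists ((10 ^+ 3) ^+ 5); first by rewrite !exprn_gt0.
move=> m n f X Y l mux muy eps x0 y0 m0 n0 fs X0 Xc Xcv Xb Y0 Yc Ycv Yb
  mux0 muy0 scx scy Xx0 Yy0 eps0.
have cX : convex_body X by [].
have cY : convex_body Y by [].
have convex y : Y y -> forall x x', f x y + dotp (grad (f^~ y) x) (x' - x)
    + mux / 2 * dotp (x' - x) (x' - x) <= f x' y.
  by move=> Yy x x'; have := (scx y Yy).2 x x'; rewrite dotpC sqr_enorm.
have concave x : X x -> forall y y', f x y' <=
    f x y + dotp (grad (f x) y) (y' - y) - muy / 2 * dotp (y' - y) (y' - y).
  move=> Xx y y'; have := (scy x Xx).2 y y'.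
  rewrite (grad_oppy fs) dotpC dotpNl sqr_enorm.
  move: (f x y) (f x y') (dotp _ _) (dotp _ _) => a b c d; lra.
have muxl : mux <= l.
  apply: (modulus_le m0 (convex y0 Yy0)) => x x'.
  by have := taylor_x fs x x' y0; rewrite ler_norml => /andP[_]; lra.
have muyl : muy <= l.
  apply: (modulus_le n0 (h := fun y => - f x0 y) (gr := grad (fun y => - f x0 y))).
    exact: (opp_lower fs concave Xx0).
  exact: (opp_upper fs x0 (lexx l)).
exact: (minimax_appa_complexity fs cX cY mux0 muxl muy0 muyl convex concave
  Xx0 Yy0 eps0 (erefl _) (erefl _) (erefl _)).
Qed.
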